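(* Let $n\ge 3$ and let $F$ be a face of the Whitehouse complex $\Delta_n$. Then $\mathrm{link}_{\Delta_n}(F)$ is homotopy equivalent to a wedge of $(c-1)!\cdot\prod_{T\in F}(c(T)-1)!$ spheres of dimension $n-4-|F|$, where $c$ is the number of connected components of the forest representation of $F$ and $c(T)$ is the number of children of the node $T$ in that forest.
   Context: The Whitehouse complex $\Delta_n$ ($n\ge 3$) is the simplicial complex with vertex set $V_n=\{S\subseteq\{2,\dots,n\}: 2\le |S|\le n-2\}$, in which a subset $F\subseteq V_n$ is a face iff for all $S,T\in F$ one has $S\subseteq T$, $T\subseteq S$, or $S\cap T=\emptyset$. Convention: the complex $\{\emptyset\}$ is regarded as the $(-1)$-dimensional sphere. The forest representation of a face $F$ is the rooted forest with node set $\{2,\dots,n\}\cup F$ (the elements $2,\dots,n$ are the leaves) in which the children of $S\in F$ are: the sets $U\in F$ with $U\subsetneq S$ such that no $W\in F$ satisfies $U\subsetneq W\subsetneq S$, and the elements $i\in S$ such that no $U\in F$ satisfies $i\in U\subsetneq S$. Its roots (one per component) are the inclusion-maximal elements of $F$ together with the elements of $\{2,\dots,n\}$ lying in no element of $F$. The link of $F$ is $\{G: F\cap G=\emptyset, F\cup G\in\Delta_n\}$. *)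

(* Defs.v *)
From HB Require Import structures.
From mathcomp Require Import all_boot all_order all_algebra.
From mathcomp Require Import all_classical all_reals all_analysis.
From mathcomp Require Import wedge_sigT subtype_topology.

Unset Strict Implicit.
Unset Printing Implicit Defensive.

Import Order.TTheory GRing.Theory Num.Theory.
Import numFieldNormedType.Exports.

Local Open Scope classical_set_scope.
Local Open Scope ring_scope.

Section Topo.
Variable R : realType.

Definition unit_interval : topologicalType := set_type (`[(0:R), 1]%classic).

Definition homotopic (X Y : topologicalType) (f g : X -> Y) : Prop :=
  exists H : R * X -> Y,
    continuous (fun p : unit_interval * X => H (set_val p.1, p.2)) /\
    (forall x, H (0, x) = f x) /\ (forall x, H (1, x) = g x).

Definition homotopy_equivalent (X Y : topologicalType) : Prop :=
  exists (f : X -> Y) (g : Y -> X),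
    [/\ continuous f, continuous g,
        homotopic X X (g \o f) idfun & homotopic Y Y (f \o g) idfun].

Definition realization (T : finType) (K : pred {set T}) : set {ptws T -> R} :=
  [set x | (forall v, 0 <= x v) /\ (\sum_(v : T) x v = 1) /\
           K (finset (fun v => x v != 0))].

Definition sphere (d : nat) : set {ptws 'I_d.+1 -> R} :=
  [set x | \sum_(i : 'I_d.+1) x i ^+ 2 = 1].

Definition sphere_pt_fun (d : nat) : {ptws 'I_d.+1 -> R} :=
  fun i => (i == ord0)%:R.

Lemma sphere_pt_in (d : nat) : sphere_pt_fun d \in sphere d.
Proof.
apply/mem_set; rewrite /sphere /= big_ord_recl /sphere_pt_fun eqxx expr1n.
rewrite big1 ?addr0 // => i _; by rewrite expr0n.
Qed.

Definition sphere_pt (d : nat) : set_type (sphere d) :=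
  exist _ (sphere_pt_fun d) (sphere_pt_in d).

Definition wedge_spheres (m d : nat) : topologicalType :=
  @wedge 'I_m (fun _ => set_type (sphere d)) (fun _ => sphere_pt d).

(* "K is homotopy equivalent to a wedge of m spheres of dimension d";
   for d = -1 we use the convention that {emptyset} is the (-1)-sphere. *)
Definition htpy_wedge_of_spheres (T : finType) (K : pred {set T})
    (m : nat) (d : int) : Prop :=
  match d with
  | Posz k => homotopy_equivalent (set_type (realization T K)) (wedge_spheres m k)
  | Negz 0 => (forall G : {set T}, K G = (G == finset.set0)) /\ m = 1%N
  | Negz _ => False
  end.

End Topo.

Arguments realization {R T} K.
Arguments htpy_wedge_of_spheres R {T} K m d.

Definition ground (n : nat) : {set 'I_n.+1} := [set i : 'I_n.+1 | (2 <= i)%N].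

Definition wvertex (n : nat) (S : {set 'I_n.+1}) : bool :=
  (S \subset ground n) && (2 <= #|S| <= n - 2)%N.

Definition wface (n : nat) (F : {set {set 'I_n.+1}}) : bool :=
  [forall S in F, wvertex n S] &&
  [forall S in F, forall U in F, [|| S \subset U, U \subset S | [disjoint S & U]]].

Definition wlink (n : nat) (F : {set {set 'I_n.+1}}) : pred {set {set 'I_n.+1}} :=
  fun G => [disjoint F & G] && wface n (F :|: G).

Definition child_sets (n : nat) (F : {set {set 'I_n.+1}}) (S : {set 'I_n.+1}) :=
  [set U in F | (U \proper S) &&
     ~~ [exists W in F, (U \proper W) && (W \proper S)]].

Definition child_leaves (n : nat) (F : {set {set 'I_n.+1}}) (S : {set 'I_n.+1}) :=
  [set i in S | ~~ [exists U in F, (i \in U) && (U \proper S)]].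

Definition nchildren (n : nat) (F : {set {set 'I_n.+1}}) (S : {set 'I_n.+1}) : nat :=
  (#|child_sets n F S| + #|child_leaves n F S|)%N.

Definition root_sets (n : nat) (F : {set {set 'I_n.+1}}) :=
  [set S in F | ~~ [exists W in F, S \proper W]].

Definition root_leaves (n : nat) (F : {set {set 'I_n.+1}}) :=
  [set i in ground n | ~~ [exists U in F, i \in U]].

Definition ncomponents (n : nat) (F : {set {set 'I_n.+1}}) : nat :=
  (#|root_sets n F| + #|root_leaves n F|)%N.

Arguments child_sets {n} F S.
Arguments child_leaves {n} F S.
Arguments nchildren {n} F S.
Arguments root_sets {n} F.
Arguments root_leaves {n} F.
Arguments ncomponents {n} F.

(* Main.v *)
Require Import Defs.
From HB Require Import structures.
From mathcomp Require Import all_boot all_order all_algebra zify.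

(** Fix a node [T] of the forest of [F] with at least three children and one
    child [a] of it. For a face [G] of the link let [top G] be the largest
    element of [G] strictly between [a] and [T], or [a] if there is none. Faces
    with top [S] can be matched by adding or removing [T :\: S], unless [T :\: S]
    is itself a child [b] of [T]; in that case they are the faces containing
    [T :\: b], that is the link of [F] with [T :\: b] added, in which [T] is left
    with two children and the new node has one child fewer than [T] had.
    By induction the link is a collapsible complex together with
    [(c - 1)! * \prod_T (c(T) - 1)!] facets of full dimension, and a complex
    obtained from a contractible one by adding [m] facets of dimension [d] is
    homotopy equivalent to a wedge of [m] spheres of dimension [d]. *)

Set Implicit Arguments.
Unset Strict Implicit.
Unset Printing Implicit Defensive.

(** * Acyclic matchings *)

(** The count rests on one identity: splitting off a child [b] at a node with c children replaces
    the factor (c - 1)! by 1! times (c - 2)!, and c - 1 children other than [a] are available. To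
    treat components like children, the ground set is added as a virtual root and every leaf as a
    singleton, so that each factor of the formula belongs to a node. The recursion stops when all
    nodes are binary. A matching alone would only count cells. To obtain a wedge, the unmatched
    faces are kept maximal throughout the induction: they can then be removed all at once, and in
    nonnegative dimension what remains is a simplicial complex whose faces, the empty one included,
    are all matched, each pair being an elementary collapse. The boundary of a facet is not a point
    in the remaining complex, but only contractible there. The attaching map therefore has to run
    the contraction near the base point of each sphere, and all maps and homotopies are written as
    explicit formulas in polar coordinates. *)

Section matching.
Variable V : finType.
Implicit Types (s D G H : {set V}) (v : V) (M N A : {set {set V}}).

(* [acyclic_matching M]: the family [M] can be exhausted, from below, by pairs
   [s], [v |: s] of which [s] is a free face at the time it is added. *)
Inductive acyclic_matching : {set {set V}} -> Prop :=
| matching_nil : acyclic_matching set0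
| matching_pair M s v : acyclic_matching M -> v \notin s ->
    (forall G, G \in M -> ~~ (s \subset G)) ->
    acyclic_matching (s |: ((v |: s) |: M)).

(** The pairs of [N] are added after those of [M]; a free face from [N] stays free because it lies
    in no member of [M]. *)
Lemma matching_cat M N : acyclic_matching M -> acyclic_matching N ->
  (forall G H, G \in M -> H \in N -> ~~ (H \subset G)) ->
  acyclic_matching (M :|: N).
Proof.
move=> aM; elim => [|{}N s v aN IH vs free] MN; first by rewrite setU0.
have -> : M :|: (s |: (v |: s |: N)) = s |: ((v |: s) |: (M :|: N)).
  by apply/setP => G; rewrite !inE; do !bool_congr; rewrite orbCA; congr (_ || _); rewrite orbCA.
apply: matching_pair => //.
  by apply: IH => G H GM HN; apply: MN => //; rewrite !inE HN !orbT.
by move=> G /setUP[GM|/free //]; apply: MN => //; rewrite !inE eqxx.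
Qed.

(** The pair whose [s] has maximal size can be added last: if [G] in [M] contains [s], then [G :\ v]
    is in [M], contains [s] and is no larger, so [G] belongs to that pair. *)
Lemma matching_toggle M v :
  (forall G, G \in M -> v |: G \in M /\ G :\ v \in M) -> acyclic_matching M.
Proof.
move: {2}#|M| (leqnn #|M|) => k; elim: k M => [|k IH] M.
  by rewrite leqn0 cards_eq0 => /eqP -> _; exact: matching_nil.
move=> cM tog; have [->|[G0 G0M]] := set_0Vmem M; first exact: matching_nil.
pose P s := (s \in M) && (v \notin s).
have P0 : P (G0 :\ v) by rewrite /P (tog _ G0M).2 !inE eqxx.
case: (arg_maxnP (fun s => #|s|) P0) => s /andP[sM vs] smax.
have vsM := (tog _ sM).1.
pose N := M :\: [set s; v |: s].
have E : M = s |: ((v |: s) |: N).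
  apply/setP => G; rewrite !inE.
  by case: eqP => [->//|_]; case: eqP => [->|_].
have D1 G : G :\ v = s -> G \in [set s; v |: s].
  move=> Gs; rewrite !inE; have [vG|vG] := boolP (v \in G).
    by rewrite -Gs setD1K // eqxx orbT.
  by rewrite -Gs (setDidPl _) ?eqxx // disjoint_sym disjoints1.
rewrite E; apply: matching_pair => //.
  apply: IH.
    rewrite -ltnS (leq_trans _ cM) //; apply: proper_card.
    rewrite properEneq subsetDl andbT; apply: contraTneq sM => <-.
    by rewrite !inE eqxx.
  move=> G; rewrite inE => /andP[GN GM]; have [vGM GvM] := tog _ GM.
  split; rewrite inE ?vGM ?GvM andbT; apply: contraNN GN; rewrite !inE.
    move=> /orP[/eqP Es|/eqP Es]; first by rewrite -Es setU11 in vs.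
    have := D1 G; rewrite !inE; apply.
    apply/setP => x; rewrite !inE; have [->|xv] /= := eqVneq x v.
      by rewrite (negPf vs).
    by move/setP: Es => /(_ x); rewrite !inE (negPf xv).
  move=> /orP[/eqP Es|/eqP Es]; first by have := D1 G Es; rewrite !inE.
  by move/setP: Es => /(_ v); rewrite !inE eqxx.
move=> G; rewrite inE => /andP[GN GM]; apply: contraNN GN => sG.
apply: D1; apply/esym/eqP; rewrite eqEcard subsetD1 sG vs /=.
by apply: smax; rewrite /P (tog _ GM).2 !inE eqxx.
Qed.

(** This carries a matching of the link of [v] over to the faces that contain [v]; joining with [v]
    changes no containment. *)
Lemma matching_link M v : acyclic_matching M ->
  (forall G, G \in M -> v \notin G) ->
  acyclic_matching [set v |: G | G in M].
Proof.
elim => [|{}M s w aM IH ws free] vM; first by rewrite imset0; exact: matching_nil.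
have vw : v != w.
  have : v \notin w |: s by apply: vM; rewrite !inE eqxx orbT.
  by rewrite !inE negb_or => /andP[].
rewrite !imsetU1 (setUCA [set v] [set w] s); apply: matching_pair.
- by apply: IH => G GM; apply: vM; rewrite !inE GM !orbT.
- by rewrite !inE negb_or eq_sym vw.
- move=> _ /imsetP[G GM ->]; apply: contraNN (free _ GM) => /subsetP sG.
  apply/subsetP => x xs; have := sG x; rewrite !inE xs orbT => /(_ isT)/orP[/eqP xv|//].
  have : v \notin s by apply: vM; rewrite !inE eqxx.
  by rewrite -xv xs.
Qed.

(** The patchwork lemma. Fibres are added by increasing size of the value of [f]; between distinct
    values of equal size monotonicity forbids any containment, so their order is arbitrary. *)
Lemma matching_fibers (E : finType) (f : {set V} -> {set E}) M :
  {in M &, forall G H, G \subset H -> f G \subset f H} ->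
  (forall S, acyclic_matching [set G in M | f G == S]) ->
  acyclic_matching M.
Proof.
move=> fmono fib.
pose below k := [set G in M | #|f G| < k].
suff main k : acyclic_matching (below k).
  have -> : M = below (\max_(G in M) #|f G|).+1; last exact: main.
  apply/setP => G; rewrite inE; case: (boolP (G \in M)) => //= GM.
  by rewrite ltnS (leq_bigmax_cond (F := fun G => #|f G|)).
elim: k => [|k IH].
  rewrite (_ : below 0 = set0); first exact: matching_nil.
  by apply/setP => G; rewrite !inE andbF.
pose level (F : seq {set E}) := [set G in M | (#|f G| == k) && (f G \in F)].
have -> : below k.+1 = below k :|: level (enum {set E}).
  apply/setP => G; rewrite !inE mem_enum ltnS leq_eqVlt orbC andbT.
  by case: (G \in M).
apply: matching_cat => //; last first.
  move=> G H; rewrite !inE => /andP[GM Gk] /andP[HM /andP[/eqP Hk _]].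
  apply: contraTN Gk => HG; rewrite -leqNgt -Hk; apply: subset_leq_card.
  exact: fmono.
elim: (enum _) (enum_uniq {set E}) => [_|S F IHF /= /andP[SF /IHF{}IHF]].
  rewrite (_ : level [::] = set0); first exact: matching_nil.
  by apply/setP => G; rewrite !inE !andbF.
have [Sk|Sk] := eqVneq #|S| k; last first.
  rewrite (_ : level _ = level F) //; apply/setP => G; rewrite !inE.
  case: eqP => //= Gk; case: eqP => // GS; by rewrite -Gk GS eqxx in Sk.
have -> : level (S :: F) = level F :|: [set G in M | f G == S].
  apply/setP => G; rewrite !inE; case: (G \in M) => //=.
  by case: (f G =P S) => [->|_]; rewrite ?Sk ?eqxx ?orbT ?orbF.
apply: matching_cat => // G H; rewrite !inE => /andP[GM /andP[/eqP Gk GF]] /andP[HM /eqP HS].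
apply: contraNN SF => HG; have := fmono _ _ HM GM HG; rewrite HS => SG.
by have /eqP -> : S == f G by rewrite eqEcard SG Gk Sk leqnn.
Qed.

End matching.

(** * The link of a forest *)

Section laminar.
Variable E : finType.
Implicit Types (S T U W B : {set E}) (L : {set {set E}}).

Definition compatible S U := [|| S \subset U, U \subset S | [disjoint S & U]].

Lemma compatible_sym S U : compatible S U = compatible U S.
Proof. by rewrite /compatible disjoint_sym orbCA. Qed.

(** With leaves represented by singletons, these are all the children of the node [T]. *)
Definition blocks L T : {set {set E}} :=
  [set U in L | (U \proper T) && ~~ [exists W in L, (U \proper W) && (W \proper T)]].

(** Without the empty set, containment and disjointness exclude each other. *)
Definition laminar L :=
  set0 \notin L /\ {in L &, forall S U, compatible S U}.

Lemma blocksP L T B : reflect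
  [/\ B \in L, B \proper T & forall W, W \in L -> B \proper W -> ~~ (W \proper T)]
  (B \in blocks L T).
Proof.
rewrite inE; apply: (iffP and3P) => -[BL BT BW]; split=> //.
  move=> W WL BpW; apply: contraNN BW => WT; apply/existsP; exists W.
  by rewrite WL BpW.
by apply/existsP => -[W /and3P[WL BpW WT]]; move/negP: (BW _ WL BpW).
Qed.

Lemma sub_blocks L T U : U \in L -> U \proper T ->
  exists2 B, B \in blocks L T & U \subset B.
Proof.
move=> UL UT; pose P W := [&& W \in L, W \proper T & U \subset W].
have PU : P U by rewrite /P UL UT subxx.
case: (arg_maxnP (fun W => #|W|) PU) => B /and3P[BL BT UB] Bmax.
exists B => //; apply/blocksP; split=> // W WL BW; apply/negP => WT.
have : #|W| <= #|B|.
  by apply: Bmax; rewrite /P WL WT (subset_trans UB (proper_sub BW)).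
by rewrite leqNgt proper_card.
Qed.

Lemma blocks_sub L T B : B \in blocks L T -> B \subset T.
Proof. by case/blocksP => _ /proper_sub. Qed.

Lemma blocks_disjoint L T B B' : laminar L -> B \in blocks L T ->
  B' \in blocks L T -> B != B' -> [disjoint B & B'].
Proof.
move=> [_ lamL] /blocksP[BL BT Bmax] /blocksP[B'L B'T B'max] BB'.
case/or3P: (lamL _ _ BL B'L) => // BsB'.
  by have := Bmax _ B'L; rewrite properEneq BB' BsB' B'T => /(_ isT).
by have := B'max _ BL; rewrite properEneq eq_sym BB' BsB' BT => /(_ isT).
Qed.

Lemma blocks_neq0 L T B : laminar L -> B \in blocks L T -> B != set0.
Proof. by move=> [L0 _] /blocksP[BL _ _]; apply: contraNneq L0 => <-. Qed.

Lemma disjoint_neq0 U W : U != set0 -> U \subset W -> ~~ [disjoint U & W].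
Proof.
move=> /set0Pn[x xU] /subsetP UW; rewrite -setI_eq0; apply/set0Pn; exists x.
by rewrite inE xU UW.
Qed.

Lemma subset_disjoint0 U S W : U != set0 -> U \subset S -> [disjoint S & W] ->
  ~~ (U \subset W).
Proof.
move=> U0 US SW; apply: contraL SW => UW; rewrite -setI_eq0.
by have [x xU] := set0Pn _ U0; apply/set0Pn; exists x; rewrite inE (subsetP US) // (subsetP UW).
Qed.

Section node.
Variables (L : {set {set E}}) (T : {set E}).
Hypothesis lamL : laminar L.
Hypothesis pts : forall x, x \in T -> [set x] \in L.
Hypothesis T2 : 1 < #|T|.

Lemma mem_blocks x : x \in T -> exists2 B, B \in blocks L T & x \in B.
Proof.
move=> xT; have xpT : [set x] \proper T.
  by rewrite properEcard sub1set xT cards1.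
have [B BT xB] := sub_blocks (pts xT) xpT; exists B => //.
by rewrite -sub1set.
Qed.

Lemma card_blocks_gt1 : 1 < #|blocks L T|.
Proof.
have [x xT] : exists x, x \in T by apply/card_gt0P; exact: ltnW.
have [B BT xB] := mem_blocks xT; have /blocksP[_ /properP[_ [y yT yB]] _] := BT.
have [B' B'T yB'] := mem_blocks yT.
apply/card_gt1P; exists B, B'; split=> //.
by apply: contraNneq yB => ->.
Qed.

Definition block_union S := forall B, B \in blocks L T -> (B \subset S) || [disjoint B & S].

Lemma block_union_compatible S : S \subset T ->
  (forall U, U \in L -> compatible S U) -> (forall B, B \in blocks L T -> ~~ (S \subset B)) ->
  block_union S.
Proof.
move=> ST cS nS B BT; have /blocksP[BL _ _] := BT.
by have := cS _ BL; rewrite /compatible (negPf (nS _ BT)) disjoint_sym.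
Qed.

Lemma block_union_block a : a \in blocks L T -> block_union a.
Proof.
move=> aT B BT; have [->|Ba] := eqVneq B a; first by rewrite subxx.
by rewrite (blocks_disjoint lamL BT aT Ba) orbT.
Qed.

(** [U] lies inside a single child of [T], and each child lies wholly in [S] or wholly in its
    complement. *)
Lemma block_union_setD S U : block_union S -> U \in L -> U \proper T ->
  (U \subset T :\: S) || [disjoint U & T :\: S].
Proof.
move=> uS UL UT; have [B BT UB] := sub_blocks UL UT.
case/orP: (uS _ BT) => BS.
  apply/orP; right; rewrite -setI_eq0; apply/eqP/setP => x; rewrite !inE.
  by apply/negP => /and3P[/(subsetP UB)/(subsetP BS) ->].
apply/orP; left; rewrite subsetD proper_sub //=.
by apply: disjointWl BS.
Qed.

(** The child that contains [T :\: S] cannot lie in [S], so it lies in [T :\: S] and equals it.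
    Being a child is thus the only way in which the complement can already be in the forest. *)
Lemma setD_in_blocks S : block_union S -> S != set0 -> S \subset T ->
  T :\: S != set0 -> T :\: S \in L -> T :\: S \in blocks L T.
Proof.
move=> uS S0 ST D0 DL.
have DT : T :\: S \proper T.
  rewrite properEneq subsetDl andbT; apply: contraNneq S0 => /setDidPl.
  by move=> /disjoint_setI0 <-; apply/eqP/esym/setIidPr.
have [B BT DB] := sub_blocks DL DT.
have BD : B \subset T :\: S.
  case/orP: (uS _ BT) => BS; last by rewrite subsetD (blocks_sub BT).
  have [x xD] := set0Pn _ D0; have := subsetP BS x (subsetP DB x xD).
  by move: xD; rewrite inE => /andP[/negPf ->].
by have /eqP -> : T :\: S == B by rewrite eqEsubset DB BD.
Qed.

End node.
End laminar.

(** * The augmented forest of a face and its link *)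

Section forests.
Variable n : nat.
Hypothesis n3 : 3 <= n.
Local Notation E := 'I_n.+1.
Local Notation X := (ground n).
Implicit Types (F G H : {set {set E}}) (S T U W B : {set E}).

Lemma card_ground : #|X| = n.-1.
Proof.
have -> : X = [set: E] :\ ord0 :\ inord 1.
  apply/setP => i; rewrite !inE -!val_eqE /= inordK; last by lia.
  by case: (nat_of_ord i) => [|[|]].
have i1 : (inord 1 : E) != ord0 by rewrite -val_eqE /= inordK //; lia.
have := cardsT E; rewrite (cardsD1 ord0) (cardsD1 (inord 1)) in_setD1 i1 !in_setT.
by rewrite card_ord !add1n => /(congr1 (fun k => k.-2)).
Qed.

(** There are [n.-1] leaves, so the bound [n - 2] excludes exactly the ground set. *)
Lemma wvertexE S : wvertex n S = (S \proper X) && (1 < #|S|).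
Proof.
rewrite /wvertex properEcard -andbA card_ground; congr (_ && _); apply/idP/idP; lia.
Qed.

Lemma wfaceP F : reflect
  ((forall S, S \in F -> wvertex n S) /\ {in F &, forall S U, compatible S U})
  (wface n F).
Proof.
apply: (iffP andP) => -[].
  move=> /forall_inP vF /forall_inP cF; split=> // S U SF UF.
  exact: (forall_inP (cF _ SF)).
move=> vF cF; split; first exact/forall_inP.
by apply/forall_inP => S SF; apply/forall_inP => U UF; exact: cF.
Qed.

Lemma sub_wface F G : F \subset G -> wface n G -> wface n F.
Proof.
move=> /subsetP FG /wfaceP[vG cG]; apply/wfaceP; split=> [S /FG/vG //|S U SF UF].
by apply: cG; exact: FG.
Qed.

Definition points : {set {set E}} := [set [set i] | i in X].
(** Leaves enter as singletons, so that inner nodes and leaves form one laminar family; vertices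
    have at least two elements, hence nothing gets identified. *)
Definition ext F := F :|: points.

Lemma compatible1 i U : compatible [set i] U.
Proof.
rewrite /compatible sub1set disjoints1; by case: (i \in U); rewrite ?orbT.
Qed.

Lemma extP F U : reflect (U \in F \/ exists2 i, i \in X & U = [set i]) (U \in ext F).
Proof.
apply: (iffP setUP) => -[]; [by left| by move/imsetP; right|by left|].
by move=> Ui; right; apply/imsetP.
Qed.

Lemma sub_ext F U : U \in F -> U \in ext F.
Proof. by move=> UF; apply/extP; left. Qed.

Lemma ext_compatible F S : (forall U, U \in F -> compatible S U) ->
  forall U, U \in ext F -> compatible S U.
Proof.
move=> cS U /extP[/cS //|[i _ ->]]; by rewrite compatible_sym compatible1.
Qed.

Lemma laminar_ext F : wface n F -> laminar (ext F).
Proof.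
move=> /wfaceP[vF cF]; split.
  apply/extP => -[/vF|[i _ /setP/(_ i)]]; last by rewrite !inE eqxx.
  by rewrite wvertexE cards0 andbF.
move=> S U /extP[SF|[i _ ->]] /extP[UF|[j _ ->]]; rewrite ?compatible1 //.
  exact: cF.
by rewrite compatible_sym compatible1.
Qed.

Lemma ext_sub F U : wface n F -> U \in ext F -> U \subset X.
Proof.
move=> /wfaceP[vF _] /extP[/vF|[i iX ->]]; last by rewrite sub1set.
by rewrite wvertexE => /andP[/proper_sub].
Qed.

Lemma ext_card F U : wface n F -> U \in ext F -> 1 < #|U| -> U \in F.
Proof. by move=> wF /extP[//|[i _ ->]]; rewrite cards1. Qed.

(** The ground set is the virtual root: its children are the roots of the forest, and its factor is
    (c - 1)!. *)
Definition nodes F := X |: F.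

Lemma node_card F T : wface n F -> T \in nodes F -> 1 < #|T|.
Proof.
move=> /wfaceP[vF _] /setU1P[->|/vF]; first by rewrite card_ground; lia.
by rewrite wvertexE => /andP[].
Qed.

Lemma node_sub F T : wface n F -> T \in nodes F -> T \subset X.
Proof.
move=> wF /setU1P[->//|TF]; apply: (ext_sub wF); apply/extP; by left.
Qed.

Lemma node_points F T x : wface n F -> T \in nodes F -> x \in T -> [set x] \in ext F.
Proof.
move=> wF TF xT; apply/extP; right; exists x => //.
exact: (subsetP (node_sub wF TF)).
Qed.

Lemma node_compatible F T U : wface n F -> T \in nodes F -> U \in ext F ->
  compatible T U.
Proof.
move=> wF /setU1P[->|TF] UF; first by rewrite /compatible (ext_sub wF UF) orbT.
have [_ c] := laminar_ext wF; apply: c => //; apply/extP; by left.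
Qed.

Lemma node_proper F T T' : wface n F -> T \in nodes F -> T' \in nodes F ->
  T \proper T' -> T \in F.
Proof.
move=> wF /setU1P[->|//] T'F XT'; have := node_sub wF T'F.
by rewrite -[_ \subset _]negbK; move: XT'; rewrite properE => /andP[_ ->].
Qed.

Lemma card_blocks F T : wface n F -> T \in nodes F ->
  #|blocks (ext F) T| = nchildren F T.
Proof.
move=> wF TF; have [vF cF] := wfaceP _ wF; have T2 := node_card wF TF.
have -> : blocks (ext F) T = child_sets F T :|: [set [set i] | i in child_leaves F T].
  apply/setP => U; apply/idP/setUP => [/blocksP[/extP[UF|[i iX ->]] UT Umax]|].
  - left; rewrite !inE UF UT /=; apply/existsP => -[W /and3P[WF UW WT]].
    by have := Umax W (sub_ext WF) UW; rewrite WT.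
  - right; apply/imsetP; exists i => //; rewrite !inE; apply/andP; split.
      by rewrite -sub1set proper_sub.
    apply/existsP => -[W /and3P[WF iW WT]].
    have iW' : [set i] \proper W.
      rewrite properEcard sub1set iW cards1; by have := vF _ WF; rewrite wvertexE => /andP[].
    by have := Umax W (sub_ext WF) iW'; rewrite WT.
  - case=> [|/imsetP[i]].
      rewrite [U \in child_sets F T]inE => /and3P[UF UT nW].
      apply/blocksP; split=> //; first exact: sub_ext.
      move=> W WE UW; apply: contraNN nW => WT; apply/existsP; exists W.
      apply/and3P; split=> //; apply: (ext_card wF WE).
      by apply: leq_ltn_trans (proper_card UW); have := vF _ UF; rewrite wvertexE => /andP[_ /ltnW].
    rewrite [i \in child_leaves F T]inE => /andP[iT nW] ->.
    apply/blocksP; split; first exact: node_points TF iT.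
      by rewrite properEcard sub1set iT cards1.
    move=> W WE iW; apply: contraNN nW => WT; apply/existsP; exists W.
    apply/and3P; split=> //; last by rewrite -sub1set proper_sub.
    apply: (ext_card wF WE); by have := proper_card iW; rewrite cards1.
rewrite cardsU card_imset; last exact: set1_inj.
rewrite (_ : _ :&: _ = set0) ?cards0 ?subn0 //; apply/setP => U; rewrite in_set0.
apply/setIP => -[]; rewrite inE => /andP[/vF]; rewrite wvertexE => /andP[_ U2 _].
by move=> /imsetP[i _ Ui]; rewrite Ui cards1 in U2.
Qed.

(** Double counting: each of the [#|F| + n.-1] members of [ext F] is a child of exactly one node,
    the smallest node properly containing it. *)
Lemma sum_blocks F : wface n F ->
  \sum_(T in nodes F) #|blocks (ext F) T| = #|F| + n.-1.
Proof.
move=> wF; have [vF cF] := wfaceP _ wF; have [E0 cE] := laminar_ext wF.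
have -> : #|F| + n.-1 = #|ext F|.
  rewrite /ext cardsU card_imset; last exact: set1_inj.
  rewrite card_ground (_ : _ :&: _ = set0) ?cards0 ?subn0 //; apply/setP => U; rewrite in_set0.
  apply/setIP => -[/vF]; rewrite wvertexE => /andP[_ U2].
  by move=> /imsetP[i _ Ui]; rewrite Ui cards1 in U2.
under eq_bigr do rewrite -sum1_card big_mkcond.
rewrite exchange_big -sum1_card [RHS]big_mkcond; apply: eq_bigr => U _ /=.
case: ifPn => UE; last first.
  by apply: big1 => T _; rewrite inE (negPf UE).
pose P T := (T \in nodes F) && (U \proper T).
have PX : P X.
  rewrite /P setU11 properEcard (ext_sub wF UE).
  case/extP: UE => [/vF|[i iX ->]]; first by rewrite wvertexE => /andP[/proper_card].
  by rewrite cards1 card_ground; lia.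
case: (arg_minnP (fun T => #|T|) PX) => T /andP[TF UT] Tmin.
rewrite (bigD1 T) //= ifT; last first.
  apply/blocksP; split=> // W WE UW; apply/negP => WT.
  have WF : W \in F.
    apply: (ext_card wF WE); apply: leq_ltn_trans (proper_card UW).
    by rewrite card_gt0; apply: contraNneq E0 => <-.
  by have := Tmin W; rewrite /P UW setU1r // => /(_ isT); rewrite leqNgt proper_card.
rewrite big1 // => T' /andP[T'F T'T]; case: ifPn => // /blocksP[_ UT' Umax].
have T'E : T' != X -> T' \in ext F.
  by move=> T'X; apply/extP; left; case/setU1P: T'F => // /eqP; rewrite (negPf T'X).
have TT' : compatible T T'.
  have [->|T'X] := eqVneq T' X; first by rewrite /compatible (node_sub wF TF).
  by apply: (node_compatible wF TF); exact: T'E.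
have U0 : U != set0 by apply: contraNneq E0 => <-.
case/or3P: TT' => [TsT'|T'sT|dTT'].
- have TpT' : T \proper T' by rewrite properEneq eq_sym T'T.
  have TE : T \in ext F by exact/sub_ext/(node_proper wF TF T'F).
  by have := Umax _ TE UT; rewrite TpT'.
- have T'pT : T' \proper T by rewrite properEneq T'T.
  have := Tmin T'; rewrite /P T'F UT' => /(_ isT).
  by rewrite leqNgt proper_card.
- have := subset_disjoint0 U0 (proper_sub UT) dTT'.
  by rewrite proper_sub.
Qed.

Lemma wlinkP F G : reflect ((forall S, S \in G -> S \notin F) /\ wface n (F :|: G))
  (wlink n F G).
Proof.
apply: (iffP andP) => -[dFG wFG]; split=> //.
  by move=> S SG; rewrite (disjointFl dFG).
rewrite disjoint_subset; apply/subsetP => S SF; rewrite inE.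
by apply: contraL SF; exact: dFG.
Qed.

Lemma wlink_sub F G H : G \subset H -> wlink n F H -> wlink n F G.
Proof.
move=> GH /wlinkP[dH wH]; apply/wlinkP; split=> [S /(subsetP GH)/dH //|].
exact: sub_wface (setUS F GH) wH.
Qed.

Lemma wlink_compatible F G : wlink n F G -> {in F :|: G &, forall S U, compatible S U}.
Proof. by case/wlinkP => _ /wfaceP[]. Qed.

Lemma wlink_vertex F G S : wlink n F G -> S \in G -> wvertex n S.
Proof. by case/wlinkP => _ /wfaceP[v _] SG; apply: v; rewrite inE SG orbT. Qed.

Lemma wlink_setU1 F G S : wlink n F G -> wvertex n S -> S \notin F ->
  (forall U, U \in F :|: G -> compatible S U) -> wlink n F (S |: G).
Proof.
move=> /wlinkP[dG /wfaceP[vG cG]] vS SF cS; apply/wlinkP; split.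
  by move=> U /setU1P[->|/dG].
rewrite setUCA; apply/wfaceP; split=> [U /setU1P[->|/vG]//|].
move=> U W /setU1P[->|UG] /setU1P[->|WG]; [|exact: cS| |exact: cG].
  by rewrite /compatible subxx.
by rewrite compatible_sym; exact: cS.
Qed.

Lemma wlink_link F G S : S \notin F ->
  wlink n (S |: F) G = (S \notin G) && wlink n F (S |: G).
Proof.
move=> SF; apply/wlinkP/andP => [[dG wG]|[SG /wlinkP[dG wG]]].
  split; first by apply/negP => /dG; rewrite setU11.
  apply/wlinkP; rewrite setUCA setUA; split=> // U /setU1P[->//|/dG].
  by rewrite !inE negb_or => /andP[].
rewrite -setUA setUCA; split=> // U UG; rewrite !inE negb_or dG ?setU1r // andbT.
by apply: contraNneq SG => <-.
Qed.

(** Take the smallest node [T] containing [S]. Then [S] is a union of children of [T]; lying in no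
    single child it contains two of them, and differing from [T] it misses a third. *)
Lemma new_vertex_node F S : wface n F -> wvertex n S -> S \notin F ->
  (forall U, U \in F -> compatible S U) ->
  exists2 T, T \in nodes F & 2 < #|blocks (ext F) T|.
Proof.
move=> wF; rewrite wvertexE => /andP[SX S2] SF cS.
have lamF := laminar_ext wF.
pose P T := (T \in nodes F) && (S \subset T).
have PX : P X by rewrite /P setU11 proper_sub.
case: (arg_minnP (fun T => #|T|) PX) => T /andP[TF ST] Tmin; exists T => //.
have pts x : x \in T -> [set x] \in ext F by exact: node_points.
have T2 := node_card wF TF.
have SpT : S \proper T.
  rewrite properEneq ST andbT; apply: contraNneq SF => SE.
  by move: TF SX; rewrite -SE => /setU1P[->|//]; rewrite properxx.
have nB B : B \in blocks (ext F) T -> ~~ (S \subset B).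
  move=> /blocksP[BL BT _]; apply/negP => SB.
  have BF : B \in F by apply: (ext_card wF BL); exact: leq_trans S2 (subset_leq_card SB).
  by have := Tmin B; rewrite /P setU1r // SB => /(_ isT); rewrite leqNgt proper_card.
have uS : block_union (ext F) T S.
  by apply: block_union_compatible ST (ext_compatible cS) nB.
have inS x : x \in S -> exists2 B, B \in blocks (ext F) T & (x \in B) && (B \subset S).
  move=> xS; have [B BT xB] := mem_blocks pts T2 (subsetP ST x xS); exists B => //.
  rewrite xB; case/orP: (uS _ BT) => // BS.
  by rewrite (disjointFr BS xB) in xS.
have [x xS] : exists x, x \in S by apply/card_gt0P; exact: ltnW.
have [B1 B1T /andP[xB1 B1S]] := inS x xS.
have /subsetPn[y yS yB1] := nB _ B1T.
have [B2 B2T /andP[yB2 B2S]] := inS y yS.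
have /properP[_ [z zT zS]] := SpT.
have [B3 B3T zB3] := mem_blocks pts T2 zT.
apply/card_gt2P; exists B1, B2, B3; split; split=> //.
- by apply: contraNneq yB1 => ->.
- by apply: contraNneq zS => BE; rewrite (subsetP B2S) // BE.
- by apply: contraNneq zS => BE; rewrite (subsetP B1S) // -BE.
Qed.

Definition weight F := \prod_(T in nodes F) (#|blocks (ext F) T|).-1`!.

(** A face with k vertices has dimension k - 1, hence [n - 3] for dimension n - 4 - |F|. Maximality
    of the members of [A] makes the remaining faces closed under subsets. *)
Definition critical F (A : {set {set {set E}}}) :=
  [/\ forall G, G \in A -> wlink n F G,
      forall G, G \in A -> #|G| + #|F| = n - 3,
      forall G H, G \in A -> wlink n F H -> G \subset H -> H = G,
      #|A| = weight F &
      acyclic_matching [set G | wlink n F G && (G \notin A)]].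

(** * Matching the link along the sets between a child and its node *)

Section split_node.
Variables (F : {set {set E}}) (T a : {set E}).
Hypotheses (wF : wface n F) (TF : T \in nodes F).
Hypothesis T3 : 2 < #|blocks (ext F) T|.
Hypothesis aT : a \in blocks (ext F) T.
Local Notation bl := (blocks (ext F) T).

Let lamF : laminar (ext F). Proof. exact: laminar_ext. Qed.
Let T2 : 1 < #|T|. Proof. exact: node_card TF. Qed.
Let pts x : x \in T -> [set x] \in ext F. Proof. exact: node_points. Qed.
Let a0 : a != set0. Proof. exact: blocks_neq0 aT. Qed.
Let apT : a \proper T. Proof. by case/blocksP: aT. Qed.

Definition chain G := a |: [set S in G | (a \subset S) && (S \proper T)].
(** Taking the union rather than a maximum makes this total and monotone in [G], as
    [matching_fibers] requires. *)
Definition top G := cover (chain G).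

Lemma top_mono G H : G \subset H -> top G \subset top H.
Proof.
move=> /subsetP GH; apply/bigcupsP => S SG; apply: bigcup_sup.
by move: SG; rewrite !inE => /orP[->//|/andP[/GH -> ->]]; rewrite orbT.
Qed.

Lemma sub_top G S : S \in chain G -> S \subset top G.
Proof. by move=> SG; exact: (bigcup_sup S). Qed.

(** All members of the chain contain the nonempty set [a], so compatibility makes them nested and
    their union is the largest of them. *)
Lemma topP G : wlink n F G -> top G \in chain G.
Proof.
move=> lG; have cG := wlink_compatible lG.
have ac : a \in chain G by rewrite setU11.
case: (arg_maxnP (fun S => #|S|) ac) => S Sc Smax.
suff -> : top G = S by [].
have aS U : U \in chain G -> a \subset U by case/setU1P => [->//|]; rewrite inE => /and3P[].
have inG U : U \in chain G -> U = a \/ U \in F :|: G.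
  by case/setU1P => [|]; [left|rewrite inE => /and3P[UG _ _]; right; rewrite inE UG orbT].
apply/eqP; rewrite eqEsubset (sub_top Sc) andbT; apply/bigcupsP => U Uc.
have : compatible U S.
  case: (inG _ Uc) => [->|UG]; first by rewrite /compatible aS.
  case: (inG _ Sc) => [->|SG]; first by rewrite /compatible aS ?orbT.
  exact: cG.
case/or3P => // [SU|dUS].
  by have /eqP -> : S == U by rewrite eqEcard SU; exact: Smax.
by have := subset_disjoint0 a0 (aS _ Uc) dUS; rewrite aS.
Qed.

Lemma chainP G S : S \in chain G -> S = a \/ [/\ S \in G, a \subset S & S \proper T].
Proof. by case/setU1P => [|]; [left|rewrite inE => /and3P; right]. Qed.

Lemma sub_a_top G : a \subset top G.
Proof. by apply: sub_top; rewrite setU11. Qed.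

Lemma top_proper G : wlink n F G -> top G \proper T.
Proof. by move=> lG; case/chainP: (topP lG) => [->|[]]. Qed.

Lemma block_of_a B : B \in bl -> a \subset B -> B = a.
Proof.
move=> BT aB; apply/eqP; apply: contraTT aB => Ba.
by apply: (subset_disjoint0 a0 (subxx a)); rewrite (blocks_disjoint lamF aT BT) // eq_sym.
Qed.

Lemma link_not_ext G S : wlink n F G -> S \in G -> S \notin ext F.
Proof.
move=> lG SG; have [dG _] := wlinkP _ _ lG; apply/negP => SE.
have := wlink_vertex lG SG; rewrite wvertexE => /andP[_ S2].
by have := dG S SG; rewrite (ext_card wF SE S2).
Qed.

(** A child containing [S] would contain [a], hence be [a]; then [S] would equal [a], which is
    already in the forest. *)
Lemma link_union G S : wlink n F G -> S \in G -> a \subset S -> S \proper T ->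
  block_union (ext F) T S.
Proof.
move=> lG SG aS ST; have cG := wlink_compatible lG.
apply: block_union_compatible (proper_sub ST) _ _.
  by apply: ext_compatible => U UF; apply: cG; rewrite inE ?SG ?UF ?orbT.
move=> B BT; apply/negP => SB.
have Ba := block_of_a BT (subset_trans aS SB).
have SE : S = a by apply/eqP; rewrite eqEsubset aS -Ba SB.
by have := link_not_ext lG SG; rewrite SE; case/blocksP: aT => ->.
Qed.

Lemma top_union G : wlink n F G -> block_union (ext F) T (top G).
Proof.
move=> lG; case/chainP: (topP lG) => [->|[SG aS ST]]; first exact: block_union_block.
exact: (link_union lG).
Qed.

Section complement.
Variable S : {set E}.
Hypotheses (S0 : S != set0) (ST : S \proper T) (uS : block_union (ext F) T S).
Local Notation D := (T :\: S).
Hypothesis nD : D \notin bl.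

Let D0 : D != set0.
Proof. by rewrite setD_eq0; case/andP: ST. Qed.

Lemma complement_notin_ext : D \notin ext F.
Proof. by apply: contraNN nD; exact: (setD_in_blocks uS S0 (proper_sub ST) D0). Qed.

Lemma complement_notin : D \notin F.
Proof. by apply: contraNN complement_notin_ext => DF; exact: sub_ext. Qed.

(** A complement with a single point would be a leaf, hence already a member of [ext F]. *)
Lemma complement_vertex : wvertex n D.
Proof.
rewrite wvertexE properEneq (subset_trans (subsetDl _ _) (node_sub wF TF)) andbT.
apply/andP; split.
  apply: contraNneq S0 => DX; rewrite -subset0; apply/subsetP => x xS.
  have : x \in D by rewrite DX (subsetP (node_sub wF TF)) // (subsetP (proper_sub ST)).
  by rewrite inE xS.
rewrite ltn_neqAle eq_sym card_gt0 D0 andbT.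
apply: contraNN complement_notin_ext => /cards1P[x Dx].
by rewrite Dx pts // (subsetP (subsetDl T S)) // Dx set11.
Qed.

Lemma complement_compatible U : compatible T U ->
  (U \proper T -> (U \subset D) || [disjoint U & D]) -> compatible D U.
Proof.
rewrite /compatible => /or3P[TU|UT|dTU] pU.
- by rewrite (subset_trans (subsetDl _ _) TU).
- have [UE|UT'] := eqVneq U T; first by rewrite UE subsetDl.
  have /pU/orP[->|] : U \proper T by rewrite properEneq UT' UT.
    by rewrite orbT.
  by rewrite disjoint_sym => ->; rewrite !orbT.
- by rewrite (disjointWl (subsetDl T S) dTU) !orbT.
Qed.

End complement.

Section toggle.
Variable S : {set E}.
Hypotheses (aS : a \subset S) (ST : S \proper T) (uS : block_union (ext F) T S).
Local Notation D := (T :\: S).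
Hypothesis nD : D \notin bl.

Let S0 : S != set0.
Proof. by apply: contraNneq a0 => SE; rewrite -subset0 -SE. Qed.

Let aD : ~~ (a \subset D).
Proof.
apply: (subset_disjoint0 a0 aS); rewrite -setI_eq0; apply/eqP/setP => x.
by rewrite !inE; case: (x \in S).
Qed.

(** The complement of [S] misses the nonempty set [a], so it never enters the chain and toggling it
    preserves the top. *)
Lemma chain_toggle G : chain (D |: G) = chain G.
Proof.
apply/setP => U; rewrite !inE; case: eqP => //= _; case: eqP => //= ->.
by rewrite (negPf aD) andbF.
Qed.

Lemma chain_toggleD G : chain (G :\ D) = chain G.
Proof.
apply/setP => U; rewrite !inE; case: eqP => //= _; case: eqP => //= ->.
by rewrite (negPf aD) andbF.
Qed.

Lemma toggle_link G : wlink n F G -> top G = S -> wlink n F (D |: G).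
Proof.
move=> lG tG; have cG := wlink_compatible lG.
apply: wlink_setU1 => //; [exact: complement_vertex|exact: complement_notin|].
move=> U UFG; apply: complement_compatible.
  case/setU1P: TF => [->|TF']; last by apply: cG => //; rewrite inE TF'.
  have /wlinkP[_ /wfaceP[v _]] := lG.
  by have := v _ UFG; rewrite wvertexE /compatible => /andP[/proper_sub ->]; rewrite orbT.
move=> UT; case/setUP: UFG => [UF|UG]; first exact: (block_union_setD uS (sub_ext UF) UT).
(* The top may be [a] itself, which belongs to [F] or is a singleton, and not to [G]. *)
have cSU : compatible S U.
  have := chainP (topP lG); rewrite tG => -[SE|[SG _ _]]; last first.
    by apply: cG; rewrite inE ?SG ?UG ?orbT.
  rewrite SE compatible_sym.
  case/blocksP: aT => /extP[aF|[i _ ->]] _ _.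
    by apply: cG; rewrite inE ?aF ?UG ?orbT.
  by rewrite compatible_sym compatible1.
have dSD : [disjoint S & D].
  by rewrite -setI_eq0; apply/eqP/setP => x; rewrite !inE; case: (x \in S).
case/or3P: cSU => [SU|US|dSU].
(* A member of [G] between [S] and [T] belongs to the chain, so it cannot exceed the top [S]. *)
- have : U \subset top G.
    by apply: sub_top; rewrite !inE UG UT (subset_trans aS SU) orbT.
  by rewrite tG => US; rewrite (disjointWl US dSD) orbT.
- by rewrite (disjointWl US dSD) orbT.
- by rewrite subsetD (proper_sub UT) disjoint_sym dSU.
Qed.

(** Toggling stays within the fibre, and the fibre avoids [A], since the members of [A] have tops
    whose complement is a child. *)
Lemma toggle_matching (A : {set {set {set E}}}) :
  (forall G, G \in A -> T :\: top G \in bl) ->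
  acyclic_matching [set G in [set G | wlink n F G && (G \notin A)] | top G == S].
Proof.
move=> Atop; apply: (matching_toggle (v := D)) => G.
rewrite !inE => /andP[/andP[lG GA] /eqP tG].
have tA H : top H = S -> H \notin A.
  by move=> tH; apply: contraNN nD => /Atop; rewrite tH.
have t1 : top (D |: G) = S by rewrite /top chain_toggle.
have t2 : top (G :\ D) = S by rewrite /top chain_toggleD.
rewrite t1 t2 !eqxx !tA // !andbT; split; first exact: toggle_link.
exact: wlink_sub (subsetDl _ _) lG.
Qed.

End toggle.

Section split_block.
Variable b : {set E}.
Hypotheses (bT : b \in bl) (ba : b != a).
Local Notation S := (T :\: b).
Local Notation F' := (S |: F).

Let b0 : b != set0. Proof. exact: blocks_neq0 bT. Qed.
Let bpT : b \proper T. Proof. by case/blocksP: bT. Qed.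

Lemma block_sub_split B : B \in bl -> B != b -> B \subset S.
Proof.
move=> BT Bb; rewrite subsetD (blocks_sub BT) /=.
exact: (blocks_disjoint lamF BT bT Bb).
Qed.

(** This is where three children matter: a child other than [b] and [S] lies inside [S], whereas
    distinct children are disjoint. *)
Lemma split_notin_blocks : S \notin bl.
Proof.
apply/negP => ST; have : 0 < #|bl :\ b :\ S|.
  move: T3; rewrite (cardsD1 b) (cardsD1 S); move: #|_| => k.
  by case: (_ \in _); case: (_ \in _); case: k.
case/card_gt0P => B; rewrite !in_setD1 => /and3P[BS Bb BT].
have := blocks_disjoint lamF BT ST BS.
by rewrite (negPf (disjoint_neq0 (blocks_neq0 lamF BT) (block_sub_split BT Bb))).
Qed.

Let ub : block_union (ext F) T b. Proof. exact: block_union_block. Qed.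

Lemma split_notin_ext : S \notin ext F.
Proof. exact: complement_notin_ext ub split_notin_blocks. Qed.

Lemma split_notin : S \notin F.
Proof. exact: complement_notin ub split_notin_blocks. Qed.

Lemma split_vertex : wvertex n S.
Proof. exact: complement_vertex ub split_notin_blocks. Qed.

Lemma split_compatible U : U \in F -> compatible S U.
Proof.
move=> UF; apply: complement_compatible.
  exact: (node_compatible wF TF (sub_ext UF)).
exact: (block_union_setD ub (sub_ext UF)).
Qed.

Lemma split_wface : wface n F'.
Proof.
have [vF cF] := wfaceP _ wF; apply/wfaceP; split=> [U /setU1P[->|/vF//]|].
  exact: split_vertex.
move=> U W /setU1P[->|UF] /setU1P[->|WF]; [|exact: split_compatible| |exact: cF].
  by rewrite /compatible subxx.
by rewrite compatible_sym; exact: split_compatible.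
Qed.

Lemma ext_split : ext F' = S |: ext F. Proof. by rewrite /ext setUA. Qed.

Lemma split_proper : S \proper T.
Proof.
rewrite properEneq subsetDl andbT; apply: contraNneq b0 => SE.
rewrite -subset0; apply/subsetP => x xb.
by have := subsetP (blocks_sub bT) x xb; rewrite -SE inE xb.
Qed.

Lemma sub_a_split : a \subset S. Proof. by apply: block_sub_split; rewrite // eq_sym. Qed.

Lemma split_not_sub B : B \in bl -> ~~ (S \subset B).
Proof.
move=> BT; apply: contraNN split_notin_ext => SB.
have Ba := block_of_a BT (subset_trans sub_a_split SB).
have -> : S = a by apply/eqP; rewrite eqEsubset sub_a_split -Ba SB.
by case/blocksP: aT.
Qed.

Lemma blocks_split_T : blocks (ext F') T = [set S; b].
Proof.
rewrite ext_split; apply/setP => U.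
apply/blocksP/set2P => [[/setU1P[->|UE] UT Umax]|]; first by left.
  right; have [B BT UB] := sub_blocks UE UT.
  have /blocksP[BE BpT _] := BT.
  have [Bb|Bb] := eqVneq B b.
    rewrite -Bb; apply/eqP; rewrite eqEsubset UB /=; apply/negPn/negP => BU.
    by have := Umax B (setU1r _ BE); rewrite properE UB BU BpT => /(_ isT).
  have := Umax S (setU11 _ _); rewrite split_proper.
  rewrite properE (subset_trans UB (block_sub_split BT Bb)) /=.
  case: (boolP (S \subset U)) => [SU _|_ /(_ isT)//].
  by have := split_not_sub BT; rewrite (subset_trans SU UB).
case=> ->; split; rewrite ?setU11 ?split_proper //.
- move=> W /setU1P[->|WE] SW; first by rewrite properxx in SW.
  apply/negP => WT; have [B BT WB] := sub_blocks WE WT.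
  by have := split_not_sub BT; rewrite (subset_trans (proper_sub SW) WB).
- by have /blocksP[bE _ _] := bT; rewrite setU1r.
- have /blocksP[_ _ bmax] := bT; move=> W /setU1P[->|WE] bW; last exact: bmax.
  have : [disjoint S & b].
    by rewrite -setI_eq0; apply/eqP/setP => x; rewrite !inE; case: (x \in b); rewrite ?andbF.
  by rewrite disjoint_sym (negPf (disjoint_neq0 b0 (proper_sub bW))).
Qed.

Lemma blocks_split_S : blocks (ext F') S = bl :\ b.
Proof.
rewrite ext_split; apply/setP => U; rewrite [in RHS]inE in_set1; apply/blocksP/andP.
  move=> [/setU1P[->|UE]]; first by rewrite properxx.
  move=> US Umax; have [B BT UB] := sub_blocks UE (proper_trans US split_proper).
  have U0 : U != set0 by have [E0 _] := lamF; apply: contraNneq E0 => <-.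
  have Bb : B != b.
    apply: contraTneq US => Bb; rewrite properE negb_and; apply/orP; left.
    rewrite subsetD negb_and; apply/orP; right.
    by rewrite disjoint_neq0 // -Bb.
  have [->//|UB'] := eqVneq U B.
  have BE : B \in ext F by case/blocksP: BT.
  have := Umax B; rewrite setU1r // properEneq UB' UB => /(_ isT isT).
  by rewrite properE block_sub_split //= negbK (negPf (split_not_sub BT)).
move=> [Ub UT]; have /blocksP[UE UpT Umax] := UT; split; first by rewrite setU1r.
  by rewrite properE block_sub_split // split_not_sub.
move=> W /setU1P[->|WE] UW; first by rewrite properxx.
by apply: contraNN (Umax W WE UW) => WS; exact: proper_trans WS split_proper.
Qed.

(** A node other than [T] properly above the new node is properly above [T] as well; [T] then stands
    in between, so the new node neither becomes a child there nor hides one. *)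
Lemma blocks_split_other T' : T' \in nodes F -> T' != T ->
  blocks (ext F') T' = blocks (ext F) T'.
Proof.
move=> T'F T'T; rewrite ext_split.
have ST' : S \proper T' -> T \proper T' /\ T \in ext F.
  move=> ST'; have : compatible T T'.
    case/setU1P: (T'F) => [->|T'F']; first by rewrite /compatible (node_sub wF TF).
    exact: (node_compatible wF TF (sub_ext T'F')).
  case/or3P=> [TT'|T'sT|dTT'].
  - have TpT' : T \proper T' by rewrite properEneq eq_sym T'T.
    by split=> //; exact/sub_ext/(node_proper wF TF T'F).
  - have T'pT : T' \proper T by rewrite properEneq T'T.
    have T'E : T' \in ext F by exact/sub_ext/(node_proper wF T'F TF).
    have [B BT T'B] := sub_blocks T'E T'pT.
    by have := split_not_sub BT; rewrite (subset_trans (proper_sub ST') T'B).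
  - have S0 : S != set0 by apply: contraNneq a0 => SE; rewrite -subset0 -SE sub_a_split.
    by have := subset_disjoint0 S0 (proper_sub split_proper) dTT'; rewrite proper_sub.
apply/setP => U; apply/blocksP/blocksP => -[UE UT' Umax].
  split=> // [|W WE]; last by apply: Umax; rewrite setU1r.
  case/setU1P: UE => [UE|//]; rewrite UE in UT' Umax.
  have [TT' TE] := ST' UT'.
  by have := Umax T (setU1r _ TE) split_proper; rewrite TT'.
split=> // [|W /setU1P[->|WE] UW]; [by rewrite setU1r| |exact: Umax].
apply/negP => /ST'[TT' TE].
by have := Umax T TE (proper_trans UW split_proper); rewrite TT'.
Qed.

Lemma weight_split : #|bl|.-1 * weight F' = weight F.
Proof.
rewrite /weight (_ : nodes F' = S |: nodes F); last by rewrite /nodes setUCA.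
have SN : S \notin nodes F.
  rewrite !inE negb_or split_notin andbT; apply: contraTneq split_vertex => ->.
  by rewrite wvertexE properxx.
rewrite big_setU1 //= (bigD1 T TF) [RHS](bigD1 T TF) /= blocks_split_S blocks_split_T.
rewrite cards2 (_ : S != b); last first.
  by apply: contraTneq bT => <-; exact: split_notin_blocks.
rewrite mul1n (eq_bigr (fun T0 => (#|blocks (ext F) T0|).-1`!)); last first.
  by move=> T' /andP[T'F T'T]; rewrite blocks_split_other.
have := cardsD1 b bl; rewrite bT add1n; case: #|bl| T3 => [|[|[|k]]] // _ [<-].
by rewrite mulnA [in RHS]/= [in RHS]factS.
Qed.

(** The top is a union of children containing [T :\: b]; if it contained [b] too, it would be all of
    [T]. *)
Lemma top_split G : wlink n F G -> S \in G -> top G = S.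
Proof.
move=> lG SG; apply/eqP; rewrite eq_sym eqEsubset.
have St : S \subset top G.
  by apply: sub_top; rewrite !inE SG sub_a_split split_proper orbT.
rewrite St /= subsetD (proper_sub (top_proper lG)) /=.
case/orP: (top_union lG bT); last by rewrite disjoint_sym.
move=> bt; have := top_proper lG; rewrite properE => /andP[_ /negP[]].
apply/subsetP => x xT; have [xb|xb] := boolP (x \in b); first exact: (subsetP bt).
by apply: (subsetP St); rewrite inE xb.
Qed.

Lemma split_link G : wlink n F' G = (S \notin G) && wlink n F (S |: G).
Proof. exact: wlink_link split_notin. Qed.

(** The set [T :\: b] is not a child, hence differs from [a]; a face with this top must therefore
    contain it, and the fibre is the link of the enlarged forest joined with the new node. *)
Lemma split_matching (A A' : {set {set {set E}}}) :
    (forall G, wlink n F G -> S \in G -> (G \in A) = (G :\ S \in A')) ->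
    acyclic_matching [set G | wlink n F' G && (G \notin A')] ->
  acyclic_matching [set G in [set G | wlink n F G && (G \notin A)] | top G == S].
Proof.
move=> AA' /(matching_link (v := S)) mA.
have -> : [set G in [set G | wlink n F G && (G \notin A)] | top G == S] =
    [set S |: G | G in [set G | wlink n F' G && (G \notin A')]].
  apply/setP => G; apply/idP/imsetP => [|[H]].
    rewrite !inE => /andP[/andP[lG GA] /eqP tG].
    have SG : S \in G.
      case/chainP: (topP lG) => [tE|[+ _ _]]; last by rewrite tG.
      by have := split_notin_blocks; rewrite -tG tE aT.
    exists (G :\ S); last by rewrite setD1K.
    by rewrite inE split_link setD1K // lG -AA' // GA !inE eqxx.
  rewrite !inE split_link => /andP[/andP[SH lH] HA] ->.
  by rewrite lH (top_split lH) ?setU11 // eqxx andbT AA' ?setU11 // setU1K.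
by apply: mA => G; rewrite inE split_link => /andP[/andP[]].
Qed.

End split_block.

Lemma critical_split :
  (forall b, b \in bl -> b != a -> exists A, critical ((T :\: b) |: F) A) ->
  exists A, critical F A.
Proof.
move=> IH; have [A_ A_P] : exists A_ : {set E} -> {set {set {set E}}},
    forall b, b \in bl -> b != a -> critical ((T :\: b) |: F) (A_ b).
  apply: (@fin_all_exists _ (fun _ => {set {set {set E}}})
    (fun b A => b \in bl -> b != a -> critical ((T :\: b) |: F) A)) => b.
  have [bT|bT] := boolP (b \in bl); last by exists set0.
  have [ba|ba] := eqVneq b a; first by exists set0.
  by have [A AP] := IH b bT ba; exists A.
pose A1 b := [set (T :\: b) |: G | G in A_ b].
pose A := \bigcup_(b in bl :\ a) A1 b.
have A_link b G : b \in bl -> b != a -> G \in A_ b ->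
    (T :\: b \notin G) /\ wlink n F ((T :\: b) |: G).
  move=> bT ba GA; have [lA _ _ _ _] := A_P b bT ba.
  by have := lA _ GA; rewrite split_link // => /andP[].
have A1P b G : b \in bl -> b != a -> G \in A1 b -> 
    [/\ wlink n F G, T :\: b \in G, top G = T :\: b & G :\ (T :\: b) \in A_ b].
  move=> bT ba /imsetP[H HA ->]; have [SH lH] := A_link b H bT ba HA.
  by rewrite setU11 setU1K // (top_split bT ba lH) ?setU11.
have AP G : G \in A -> exists b, [/\ b \in bl, b != a & G \in A1 b].
  by case/bigcupP => b; rewrite in_setD1 => /andP[ba bT] GA; exists b.
have DD b c : b \in bl -> c \in bl -> T :\: b = T :\: c -> b = c.
  move=> bT cT E; have D d : d \in bl -> T :\: (T :\: d) = d.
    by move=> dT; rewrite setDDr setDv set0U; apply/setIidPr/(blocks_sub dT).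
  by rewrite -(D b) // E D.
have AE b G : b \in bl -> b != a -> wlink n F G -> T :\: b \in G ->
    (G \in A) = (G :\ (T :\: b) \in A_ b).
  move=> bT ba lG SG; apply/idP/idP => [/AP[c [cT ca GA]]|GA].
    have [_ _ tG Gc] := A1P c G cT ca GA; rewrite (top_split bT ba lG SG) in tG.
    by rewrite (DD _ _ bT cT tG).
  apply/bigcupP; exists b; first by rewrite in_setD1 ba.
  by apply/imsetP; exists (G :\ (T :\: b)); rewrite // setD1K.
exists A; split.
- by move=> G /AP[b [bT ba GA]]; have [] := A1P b G bT ba GA.
- move=> G /AP[b [bT ba GA]]; have [_ SG _ Gb] := A1P b G bT ba GA.
  have [_ cA _ _ _] := A_P b bT ba.
  by rewrite -(cA _ Gb) cardsU1 split_notin // (cardsD1 (T :\: b) G) SG [RHS]addnCA addnA.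
- move=> G H /AP[b [bT ba GA]] lH GH; have [_ SG _ Gb] := A1P b G bT ba GA.
  have [_ _ mA _ _] := A_P b bT ba; have SH := subsetP GH _ SG.
  rewrite -(setD1K SH) -(setD1K SG) (mA _ _ Gb _ (setSD _ GH)) //.
  by rewrite split_link // setD1K // lH !inE eqxx.
- have -> : #|A| = \sum_(b in bl :\ a) #|A1 b|.
    (* Families with index outside the range are made empty, so that disjointness holds for all
       pairs of distinct indices. *)
    pose A2 b := if b \in bl :\ a then A1 b else set0.
    rewrite /A big_mkcond -/A2 -sum1_card partition_disjoint_bigcup.
      rewrite [RHS]big_mkcond; apply: eq_bigr => b _.
      by rewrite sum1_card /A2; case: ifP => // _; rewrite cards0.
    move=> b c bc; rewrite /A2; case: ifP => [|_]; last by rewrite -setI_eq0 set0I.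
    rewrite in_setD1 => /andP[ba bT]; case: ifP => [|_]; last by rewrite -setI_eq0 setI0.
    rewrite in_setD1 => /andP[ca cT]; rewrite -setI_eq0; apply/set0Pn => -[G /setIP[Gb Gc]].
    have [_ _ t1 _] := A1P b G bT ba Gb; have [_ _ t2 _] := A1P c G cT ca Gc.
    by case/eqP: bc; apply: DD => //; rewrite -t1 -t2.
  have [b0 b0P] : exists b, b \in bl :\ a.
    by apply/card_gt0P; move: T3; rewrite (cardsD1 a) aT; case: #|_|.
  pose w := weight ((T :\: b0) |: F).
  (* All c - 1 families have the same size; the equation is multiplied out to avoid dividing
     [weight F] by c - 1. *)
  have wE b : b \in bl :\ a -> #|bl|.-1 * #|A1 b| = weight F.
    rewrite in_setD1 => /andP[ba bT]; have [_ _ _ cA _] := A_P b bT ba.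
    rewrite card_in_imset ?cA ?weight_split // => G H GA HA E.
    have [SG _] := A_link b G bT ba GA; have [SH _] := A_link b H bT ba HA.
    by rewrite -(setU1K SG) -(setU1K SH) E.
  have bl1 : #|bl|.-1 = #|bl :\ a| by rewrite (cardsD1 a) aT.
  have n0 : 0 < #|bl|.-1 by move: T3; case: #|bl| => [|[]].
  have -> : \sum_(b in bl :\ a) #|A1 b| = \sum_(b in bl :\ a) #|A1 b0|.
    apply: eq_bigr => b bP; apply/eqP; rewrite -(eqn_pmul2l n0).
    by rewrite (wE b bP) (wE b0 b0P).
  by rewrite sum_nat_const -bl1 wE.
- apply: (matching_fibers (f := top)) => [G H _ _|S]; first exact: top_mono.
  have [/existsP[G /andP[lG /eqP tG]]|/existsPn nG] :=
      boolP [exists G, wlink n F G && (top G == S)]; last first.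
    rewrite (_ : [set _ in _ | _] = set0); first exact: matching_nil.
    apply/setP => G; rewrite !inE; have := nG G.
    by case: (wlink n F G) => //= /negPf ->; rewrite andbF.
  have aS : a \subset S by rewrite -tG; exact: sub_a_top.
  have ST : S \proper T by rewrite -tG; exact: top_proper.
  have uS : block_union (ext F) T S by rewrite -tG; exact: top_union.
  have [DT|nD] := boolP (T :\: S \in bl); last first.
    apply: toggle_matching => // H /AP[b [bT ba HA]].
    have [_ _ -> _] := A1P b H bT ba HA.
    by rewrite setDDr setDv set0U (setIidPr (blocks_sub bT)).
  have SE : S = T :\: (T :\: S).
    by rewrite setDDr setDv set0U (setIidPr (proper_sub ST)).
  have ba : T :\: S != a.
    have [x xa] := set0Pn _ a0; apply: contraTneq (subsetP aS x xa) => E.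
    by move: xa; rewrite -E inE => /andP[].
  have [_ _ _ _ mA] := A_P _ DT ba.
  by rewrite SE; apply: split_matching mA => // H lH SH; exact: AE.
Qed.

End split_node.

(** With two children at every node no further vertex fits, so the link is the empty face alone.
    Counting children gives 2(|F| + 1) = |F| + n - 1, that is |F| = n - 3, the size required of the
    empty face. *)
Lemma critical_binary F : wface n F ->
  (forall T, T \in nodes F -> #|blocks (ext F) T| <= 2) -> critical F [set set0].
Proof.
move=> wF nb2; have nb T : T \in nodes F -> #|blocks (ext F) T| = 2.
  move=> TF; apply/eqP; rewrite eqn_leq nb2 //=.
  by apply: card_blocks_gt1 (node_card wF TF) => x; exact: node_points.
have l0 G : wlink n F G -> G = set0.
  move=> lG; apply/eqP/set0Pn => -[S SG]; have cG := wlink_compatible lG.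
  have [dG _] := wlinkP _ _ lG.
  have [|T TF] := new_vertex_node wF (wlink_vertex lG SG) (dG S SG).
    by move=> U UF; apply: cG; rewrite inE ?SG ?UF ?orbT.
  by rewrite nb.
have lk0 : wlink n F set0 by apply/wlinkP; rewrite setU0; split=> // S; rewrite inE.
have XF : X \notin F.
  by apply/negP => XF; have [/(_ X XF)] := wfaceP _ wF; rewrite wvertexE properxx.
split.
- by move=> G /set1P ->.
- move=> G /set1P ->; have := sum_blocks wF.
  rewrite (eq_bigr (fun=> 2)) // sum_nat_const cardsU1 XF cards0 add0n /=.
  by move: #|F| n3 => k; lia.
- by move=> G H _ /l0 -> ; rewrite subset0 => /eqP.
- by rewrite cards1 /weight big1 // => T TF; rewrite nb.
- rewrite (_ : [set _ | _] = set0); first exact: matching_nil.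
  by apply/setP => G; rewrite !inE; apply/negP => /andP[/l0 ->]; rewrite eqxx.
Qed.

(** Every split adds a set to [F], so the number of sets outside [F] decreases. *)
Lemma critical_exists F : wface n F -> exists A, critical F A.
Proof.
have [k] := ubnP (#|{: {set E}}| - #|F|); elim: k F => // k IH F Fk wF.
have [/existsP[T /andP[TF T3]]|/existsPn nT] :=
    boolP [exists T, (T \in nodes F) && (2 < #|blocks (ext F) T|)]; last first.
  exists [set set0]; apply: critical_binary => // T TF.
  by have := nT T; rewrite TF /= -leqNgt.
have [a aT] : exists a, a \in blocks (ext F) T by apply/card_gt0P; case: #|_| T3.
apply: (critical_split wF TF T3 aT) => b bT ba; apply: IH; last first.
  exact: split_wface.
have SF : T :\: b \notin F by exact: split_notin.
have : #|(T :\: b) |: F| <= #|{: {set E}}| by exact: max_card.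
by move: Fk; rewrite cardsU1 SF; move: #|F| #|{: {set E}}| => p q /=; lia.
Qed.

Lemma weightE F : wface n F ->
  weight F = (ncomponents F).-1`! * \prod_(S in F) (nchildren F S).-1`!.
Proof.
move=> wF; have [vF _] := wfaceP _ wF.
have XF : X \notin F.
  by apply/negP => /vF; rewrite wvertexE properxx.
have Fp S : S \in F -> S \proper X by move=> /vF; rewrite wvertexE => /andP[].
rewrite /weight big_setU1 //= (card_blocks wF (setU11 _ _)) /nchildren.
have -> : child_sets F X = root_sets F.
  apply/setP => S; rewrite !inE; have [SF|//] := boolP (S \in F).
  rewrite Fp //=; congr (~~ _); apply: eq_existsb => W.
  by have [WF|//] := boolP (W \in F); rewrite (Fp W) // andbT.
have -> : child_leaves F X = root_leaves F.
  apply/setP => i; rewrite !inE; congr (_ && ~~ _); apply: eq_existsb => W.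
  by have [WF|//] := boolP (W \in F); rewrite (Fp W) // andbT.
congr (_ * _).
by apply: eq_bigr => S SF; rewrite card_blocks // setU1r.
Qed.

End forests.

From mathcomp Require Import all_classical all_reals all_analysis.
From mathcomp Require Import wedge_sigT subtype_topology ring lra.

Import Order.TTheory GRing.Theory Num.Theory.
Import numFieldNormedType.Exports.

Local Open Scope classical_set_scope.
Local Open Scope ring_scope.

(** * Continuity and homotopy *)

Lemma set_val_continuous (X : topologicalType) (A : set X) :
  continuous (set_val : set_type A -> X).
Proof. exact: initial_continuous. Qed.

Lemma continuous_set_typeP (Z X : topologicalType) (A : set X)
    (f : Z -> set_type A) :
  continuous (set_val \o f) -> continuous f.
Proof.
move=> /continuousP cf; apply/continuousP => B [C oC <-].
exact: cf.
Qed.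

Lemma continuous_comp_fun (X Y Z : topologicalType) (g : Y -> Z) (f : X -> Y) :
  continuous g -> continuous f -> continuous (g \o f).
Proof. by move=> cg cf x; apply: continuous_comp; [exact: cf|exact: cg]. Qed.

Lemma continuous_pair (X Y Z : topologicalType) (f : Z -> X) (g : Z -> Y) :
  continuous f -> continuous g -> continuous (fun z => (f z, g z)).
Proof. by move=> cf cg z; apply: cvg_pair; [exact: cf|exact: cg]. Qed.

Lemma continuous_ptwsP (Z : topologicalType) (I : choiceType)
    (Y : topologicalType) (f : Z -> {ptws I -> Y}) :
  (forall i, continuous (fun z => f z i)) -> continuous f.
Proof.
move=> cf z; apply/cvg_sup => i U [_ [[C oC <-] Cz] CU].
by apply: filterS CU _; apply: cf; exact: open_nbhs_nbhs.
Qed.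

Lemma continuous_paste (Z Y : topologicalType) (I : finType) (C : I -> set Z)
    (f : Z -> Y) :
    (forall i, closed (C i)) -> (forall z, exists i, C i z) ->
    (forall i, continuous (f \o (set_val : set_type (C i) -> Z))) ->
  continuous f.
Proof.
move=> clC covC cf; apply/continuous_closedP => B clB.
have -> : f @^-1` B = \bigcup_(i in setT) (C i `&` f @^-1` B).
  rewrite eqEsubset; split => z /=; last by case=> i _ [].
  by move=> Bz; have [i Ci] := covC z; exists i.
apply: closed_bigcup => [|i _]; first exact: finite_finset.
have /continuous_closedP/(_ _ clB) := cf i.
(* A set open in the subspace is the trace of an open set [D] of [Z]. *)
rewrite -openC => -[D oD DE].
have -> : C i `&` f @^-1` B = C i `&` ~` D.
  rewrite eqEsubset; split => z [Cz].
    move=> /= Bz; split => // Dz.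
    have : (~` ((f \o (set_val : set_type (C i) -> Z)) @^-1` B))
              (exist _ z (mem_set Cz)) by rewrite -DE.
    exact.
  move=> nDz; split => //=; apply: contrapT => nB.
  have : (~` ((f \o (set_val : set_type (C i) -> Z)) @^-1` B))
              (exist _ z (mem_set Cz)) by [].
  by rewrite -DE.
apply: closedI => //; exact: open_closedC.
Qed.

Section real_valued.
Variables (R : realType) (Z : topologicalType).
Implicit Types f g : Z -> R.

Lemma continuous_add f g : continuous f -> continuous g ->
  continuous (fun z => f z + g z).
Proof. by move=> cf cg z; apply: cvgD; [exact: cf|exact: cg]. Qed.

Lemma continuous_opp f : continuous f -> continuous (fun z => - f z).
Proof. by move=> cf z; apply: cvgN; exact: cf. Qed.

Lemma continuous_sub f g : continuous f -> continuous g ->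
  continuous (fun z => f z - g z).
Proof. by move=> cf cg z; apply: cvgB; [exact: cf|exact: cg]. Qed.

Lemma continuous_mul f g : continuous f -> continuous g ->
  continuous (fun z => f z * g z).
Proof. by move=> cf cg z; apply: cvgM; [exact: cf|exact: cg]. Qed.

Lemma continuous_div f g : (forall z, g z != 0) ->
  continuous f -> continuous g -> continuous (fun z => f z / g z).
Proof.
move=> g0 cf cg z; apply: cvgM; first exact: cf.
by apply: cvgV; [exact: g0|exact: cg].
Qed.

Lemma continuous_inv f : (forall z, f z != 0) -> continuous f ->
  continuous (fun z => (f z)^-1).
Proof. by move=> f0 cf z; apply: cvgV; [exact: f0|exact: cf]. Qed.

Lemma continuous_maxf f g : continuous f -> continuous g ->
  continuous (fun z => Num.max (f z) (g z)).
Proof. by move=> cf cg z; apply: continuous_max; [exact: cf|exact: cg]. Qed.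

Lemma continuous_minf f g : continuous f -> continuous g ->
  continuous (fun z => Num.min (f z) (g z)).
Proof. by move=> cf cg z; apply: continuous_min; [exact: cf|exact: cg]. Qed.

Lemma continuous_norm f : continuous f -> continuous (fun z => `|f z|).
Proof. by move=> cf z; apply: cvg_norm; exact: cf. Qed.

Lemma continuous_sqrt f : continuous f -> continuous (fun z => Num.sqrt (f z)).
Proof. by move=> cf z; apply: continuous_comp; [exact: cf|exact: sqrt_continuous]. Qed.

Lemma continuous_bigf (I : Type) (r : seq I) (P : pred I) (op : R -> R -> R)
    (x0 : R) (F : I -> Z -> R) :
    (forall f g, continuous f -> continuous g ->
      continuous (fun z => op (f z) (g z))) ->
    (forall i, continuous (F i)) ->
  continuous (fun z => \big[op/x0]_(i <- r | P i) F i z).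
Proof.
move=> cop cF; elim: r => [|i r IH].
  by under eq_fun do rewrite big_nil; exact: cst_continuous.
under eq_fun do rewrite big_cons.
by case: (P i) => //; exact: cop.
Qed.

Lemma closed_le_fun f g : continuous f -> continuous g ->
  closed [set z | f z <= g z].
Proof.
move=> cf cg; have -> : [set z | f z <= g z] = (fun z => g z - f z) @^-1` [set x | 0 <= x].
  by rewrite eqEsubset; split => z /=; rewrite subr_ge0.
apply: preimage_closed; [by move=> z _; exact: (continuous_sub cg cf)|exact: closed_ge].
Qed.

End real_valued.

Lemma ptws_eval_continuous (I : choiceType) (Y : topologicalType) (i : I) :
  continuous (fun x : {ptws I -> Y} => x i).
Proof. exact: proj_continuous. Qed.

Lemma continuous_ptws_val (R : realType) (Z : topologicalType) (I : choiceType)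
   (A : set {ptws I -> R}) (f : Z -> set_type A) (i : I) :
  continuous f -> continuous (fun z => set_val (f z) i).
Proof.
move=> cf.
exact: (continuous_comp_fun (@ptws_eval_continuous I R i)
  (continuous_comp_fun (@set_val_continuous _ A) cf)).
Qed.

Section homotopy.
Variable R : realType.
Local Notation I01 := (unit_interval R).

Lemma unit_intervalP (t : I01) : 0 <= set_val t <= 1.
Proof. by have := set_valP t; rewrite /= in_itv. Qed.


Lemma zero_in_I01 : (0 : R) \in (`[0, 1]%classic : set R).
Proof. by rewrite inE /= in_itv /= lexx ler01. Qed.

Definition I01_0 : I01 := exist _ 0 zero_in_I01.

End homotopy.

(** Outside [A] the value is the default [x0]; formulas can thus be written on all of [R * X],
    although they make sense only for times in the unit interval. *)
Definition into (T : Type) (A : set T) (x0 : set_type A) (y : T) : set_type A :=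
  insubd x0 y.

Lemma intoE (T : Type) (A : set T) (x0 : set_type A) (y : T) :
  A y -> set_val (into x0 y) = y.
Proof. by move=> Ay; rewrite /into /set_val /= insubdK //; exact: mem_set. Qed.

Lemma set_val_inj (T : Type) (A : set T) : injective (set_val : set_type A -> T).
Proof. exact: val_inj. Qed.

Lemma continuous_into (Z X : topologicalType) (A : set X)
    (x0 : Z -> set_type A) (f : Z -> X) :
  (forall z, A (f z)) -> continuous f -> continuous (fun z => into (x0 z) (f z)).
Proof.
move=> Af cf; apply: continuous_set_typeP.
by rewrite (_ : _ \o _ = f) //; apply/funext => z /=; rewrite intoE.
Qed.

Section homotopic.
Variable R : realType.
Local Notation I01 := (unit_interval R).

Lemma homotopic_comp (X Y X' Y' : topologicalType) (f g : X -> Y)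
    (k : X' -> X) (l : Y -> Y') :
  continuous k -> continuous l -> homotopic R X Y f g ->
  homotopic R X' Y' (l \o f \o k) (l \o g \o k).
Proof.
move=> ck cl [H [cH [H0 H1]]].
exists (fun p => l (H (p.1, k p.2))); split => /=.
  apply: (@continuous_comp_fun _ _ _ l); first exact: cl.
  apply: (@continuous_comp_fun _ _ _ (fun p : I01 * X => H (set_val p.1, p.2))
    (fun p : I01 * X' => (p.1, k p.2))); first exact: cH.
  apply: continuous_pair => [?|]; first exact: cvg_fst.
  by apply: continuous_comp_fun => //; move=> ?; exact: cvg_snd.
by split => x; rewrite ?H0 ?H1.
Qed.

(** A homotopy is continuous only over the unit interval, so a time function with values there has
    to be factored through [unit_interval] first. *)
Lemma homotopy_comp_continuous (X Y Z : topologicalType) (H : R * X -> Y)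
    (t : Z -> R) (k : Z -> X) :
  continuous (fun p : I01 * X => H (set_val p.1, p.2)) ->
  (forall z, 0 <= t z <= 1) -> continuous t -> continuous k ->
  continuous (fun z => H (t z, k z)).
Proof.
move=> cH t01 ct ck.
have -> : (fun z => H (t z, k z)) = (fun p : I01 * X => H (set_val p.1, p.2)) \o
    (fun z => (into (I01_0 R) (t z), k z)).
  by apply/funext => z /=; rewrite intoE //= in_itv /=.
apply: continuous_comp_fun => //; apply: continuous_pair => //.
by apply: continuous_into => // z; rewrite /= in_itv /=.
Qed.

Lemma fst_val_continuous (X : topologicalType) :
  continuous (fun p : I01 * X => set_val p.1).
Proof.
apply: continuous_comp_fun; first exact: set_val_continuous.
by move=> ?; exact: cvg_fst.
Qed.

Lemma snd_continuous (X Y : topologicalType) : continuous (fun p : X * Y => p.2).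
Proof. by move=> ?; exact: cvg_snd. Qed.

Lemma homotopic_trans (X Y : topologicalType) (f g h : X -> Y) :
  homotopic R X Y f g -> homotopic R X Y g h -> homotopic R X Y f h.
Proof.
move=> [H [cH [H0 H1]]] [K [cK [K0 K1]]].
exists (fun p => if p.1 <= 2^-1 then H (p.1 * 2, p.2) else K (p.1 * 2 - 1, p.2)).
split => /=; last first.
  split => x; first by rewrite invr_ge0 ler0n mul0r.
  rewrite ifF; last by apply/negbTE; rewrite -ltNge; lra.
  by rewrite (_ : 1 * 2 - 1 = 1) ?K1; last by lra.
pose C (b : bool) : set (I01 * X) :=
  if b then [set p | set_val p.1 <= 2^-1] else [set p | 2^-1 <= set_val p.1].
have cfst := @fst_val_continuous X.
have ccst (c : R) : continuous (fun _ : I01 * X => c) by exact: cst_continuous.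
apply: (@continuous_paste _ _ bool C) => [[]|p|[]] /=.
- exact: closed_le_fun.
- exact: closed_le_fun.
- by have [?|/ltW ?] := leP (set_val p.1) 2^-1; [exists true|exists false].
- rewrite (_ : _ \o _ = fun z : set_type (C true) =>
    H (set_val (set_val z).1 * 2, (set_val z).2)); last first.
    by apply/funext => z /=; have /= : C true (set_val z) := set_valP z; move=> ->.
  apply: homotopy_comp_continuous => //.
  + move=> z; have /= : C true (set_val z) := set_valP z.
    by have := unit_intervalP (set_val z).1; lra.
  + apply: continuous_mul; last exact: cst_continuous.
    exact: continuous_comp_fun cfst (@set_val_continuous _ _).
  + exact: continuous_comp_fun (@snd_continuous _ _) (@set_val_continuous _ _).
- rewrite (_ : _ \o _ = fun z : set_type (C false) =>
    K (set_val (set_val z).1 * 2 - 1, (set_val z).2)); last first.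
    apply/funext => z /=; have : C false (set_val z) := set_valP z.
    case: (set_val z) => t x /= tC; case: ifP => // tC'.
    (* On the overlap of the two closed halves both branches equal [g]. *)
    have -> : set_val t = 2^-1 by apply/eqP; rewrite eq_le tC tC'.
    by rewrite mulVf ?pnatr_eq0// subrr H1 K0.
  apply: homotopy_comp_continuous => //.
  + move=> z; have /= : C false (set_val z) := set_valP z.
    by have := unit_intervalP (set_val z).1; lra.
  + apply: continuous_sub; last exact: cst_continuous.
    apply: continuous_mul; last exact: cst_continuous.
    exact: continuous_comp_fun cfst (@set_val_continuous _ _).
  + exact: continuous_comp_fun (@snd_continuous _ _) (@set_val_continuous _ _).
Qed.

Lemma homotopic_sym (X Y : topologicalType) (f g : X -> Y) :
  homotopic R X Y f g -> homotopic R X Y g f.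
Proof.
move=> [H [cH [H0 H1]]]; exists (fun p => H (1 - p.1, p.2)).
split; last by split => x /=; rewrite ?subr0 ?subrr.
apply: (homotopy_comp_continuous cH) => [[t x] /=||].
- by have := unit_intervalP t; lra.
- by apply: continuous_sub; [exact: cst_continuous|exact: fst_val_continuous].
- exact: snd_continuous.
Qed.

End homotopic.

(** * Polyhedra and collapses *)

Definition downclosed (T : finType) (K : pred {set T}) : Prop :=
  forall G H : {set T}, G \subset H -> K H -> K G.

Section realization.
Variables (R : realType) (T : finType).
Implicit Types (K L : pred {set T}) (x y : {ptws T -> R}) (s : {set T}).

Definition polyhedron K : topologicalType := set_type (@realization R T K).

Definition supp x : {set T} := finset (fun v => x v != 0).

Lemma in_supp x u : (u \in supp x) = (x u != 0).
Proof. by rewrite inE. Qed.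

Lemma realization_le1 K x : realization K x -> forall u, x u <= 1.
Proof.
by move=> [x0 [<- _]] u; rewrite (bigD1 u) //= lerDl sumr_ge0.
Qed.

Lemma realization_sum_supp K x s : realization K x -> supp x \subset s ->
  \sum_(u in s) x u = 1.
Proof.
move=> [_ [<- _]] xs; rewrite [RHS](bigID (mem s)) /= [X in _ = _ + X]big1 ?addr0 //.
by move=> u us; apply/eqP; apply: contraNT us => xu; apply: (fintype.subsetP xs); rewrite in_supp.
Qed.

Lemma realization_sub K L : (forall s, K s -> L s) ->
  realization K `<=` (realization L : set {ptws T -> R}).
Proof. by move=> KL x [x0 [x1 Kx]]; split=> //; split=> //; exact: KL. Qed.

Lemma polyhedron_eval_continuous K (u : T) :
  continuous (fun x : polyhedron K => set_val x u).
Proof. by apply: continuous_ptws_val => x; exact: cvg_id. Qed.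

Definition contractible K : Prop :=
  exists p : polyhedron K, homotopic R (polyhedron K) (polyhedron K) idfun (fun _ => p).

Lemma eq_contractible K L : K =1 L -> contractible K -> contractible L.
Proof. by move=> /funext ->. Qed.

Lemma point_contractible K (v : T) :
  (forall s, K s = (s \subset [set v]%SET)) -> contractible K.
Proof.
move=> KE.
have pK : (fun u => (u == v)%:R) \in (realization K : set {ptws T -> R}).
  apply/mem_set; split => [u|]; first by case: eqP.
  split; last first.
    rewrite KE; apply/fintype.subsetP => u; rewrite !inE.
    by case: (u == v); rewrite ?eqxx.
  by rewrite (bigD1 v) //= eqxx big1 ?addr0 // => u /negPf ->.
pose p : polyhedron K := exist (fun x : {ptws T -> R} => x \in realization K) _ pK.
exists p; have E (x : polyhedron K) : x = p.
  apply: set_val_inj; apply/funext => u.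
  have -> : set_val p u = (u == v)%:R by [].
  have xK : realization K (set_val x) := set_valP x.
  have := xK => -[_ [_]]; rewrite KE => xv.
  have := realization_sum_supp xK xv; rewrite big_set1 => xv1.
  have [->|uv] := eqVneq u v; first by rewrite xv1.
  by apply/eqP; apply: contraNT uv => xu; have := fintype.subsetP xv u; rewrite !inE; apply.
exists (fun=> p); split; first exact: cst_continuous.
by split=> // x; rewrite [RHS]E.
Qed.

(* The deformation pushes a point away from the vertex barycentre of the free
   face [s] towards [v], at constant speed until a coordinate in [s] vanishes. *)
Lemma collapse_contractible K s (v : T) :
    downclosed K -> v \notin s -> s != finset.set0 -> K (v |: s)%SET ->
    (forall G, K G -> s \subset G -> G \subset (v |: s)%SET) ->
    contractible (fun G => K G && ~~ (s \subset G)) -> contractible K.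
Proof.
move=> dK vs s0 Kvs free [p hp].
set L := fun G => _ in p hp.
(* The base value 1 does not affect the minimum on the polyhedron: [s] is nonempty and all
   coordinates are at most 1. *)
pose mu x := \big[Num.min/1]_(u in s) x u.
(* Each vertex of [s] loses [t * mu x] and [v] receives all [#|s|] shares, so the sum is
   preserved. *)
pose r (t : R) x : {ptws T -> R} := fun u =>
  x u + t * mu x * ((u == v)%:R * #|s|%:R - (u \in s)%:R).
have mu_le x u : u \in s -> mu x <= x u by move=> us; exact: bigmin_le_cond.
have mu_ge0 x : realization K x -> 0 <= mu x.
  by move=> [x0 _]; apply: le_bigmin.
have mu_supp x : realization K x -> ~~ (s \subset supp x) -> mu x = 0.
  move=> Kx /subsetPn[u us]; rewrite in_supp negbK => /eqP xu.
  by apply/eqP; rewrite eq_le mu_ge0 // andbT -xu mu_le.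
have r0 t x : mu x = 0 -> r t x = x.
  by move=> m0; apply/funext => u; rewrite /r m0 mulr0 mul0r addr0.
have rK t x : 0 <= t <= 1 -> realization K x -> realization K (r t x).
  move=> /andP[t0 t1] Kx; have m0 := mu_ge0 _ Kx.
  have [sx|sx] := boolP (s \subset supp x); last by rewrite r0 // mu_supp.
  have [x0 [x1 KGx]] := Kx; have xvs := free _ KGx sx.
  split => [u|].
    rewrite /r; have [us|us] := boolP (u \in s).
      have -> : (u == v) = false by apply: contraNF vs => /eqP <-.
      rewrite mul0r sub0r mulrN1 subr_ge0 (le_trans _ (mu_le _ _ us)) //.
      by rewrite ler_piMl.
    rewrite subr0 addr_ge0 ?x0// !mulr_ge0//.
  split.
    rewrite big_split /= x1 -mulr_sumr sumrB -mulr_suml.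
    rewrite (bigD1 v) //= eqxx big1 ?addr0 ?mul1r; last by move=> u /negPf ->.
    rewrite -sum1_card big_mkcond natr_sum -sumrB big1 ?mulr0 ?addr0 // => u _.
    by case: (u \in s); rewrite subrr.
  (* A point that moves has its support in [v |: s], because [s] is free, and keeps it there. *)
  apply: dK Kvs; apply/fintype.subsetP => u; rewrite !inE; apply: contraNT.
  rewrite negb_or => /andP[uv us]; rewrite /r (negPf uv) (negPf us) mul0r subr0 mulr0 addr0.
  by apply: contraNT uv => xu; have := fintype.subsetP xvs u; rewrite !inE (negPf us) orbF; apply.
have r1L x : realization K x -> realization L (r 1 x).
  have one_itv01 : 0 <= (1 : R) <= 1 by rewrite lexx ler01.
  move=> Kx; have [y0 [y1 Ky]] := rK 1 _ one_itv01 Kx.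
  split=> //; split=> //; rewrite /L Ky /=; apply/subsetPn.
  have [u us mxu] : exists2 u, u \in s & mu x = x u.
    have [w ws] := finset.set0Pn _ s0.
    have [//||u us E] := @eq_bigmin _ _ _ 1 w (mem s) x; last by exists u.
    by move=> ? _; exact: realization_le1 Kx _.
  exists u => //; rewrite in_supp /r negbK mxu us.
  have -> : (u == v) = false by apply: contraNF vs => /eqP <-.
  by rewrite mul0r sub0r mul1r mulrN1 subrr.
have LK x : realization L x -> realization K x.
  by apply: realization_sub => G /andP[].
pose incl (x : polyhedron L) : polyhedron K :=
  exist _ (set_val x) (mem_set (LK _ (set_valP x))).
pose ret (x : polyhedron K) : polyhedron L :=
  exist _ (r 1 (set_val x)) (mem_set (r1L _ (set_valP x))).
have cincl : continuous incl.
  apply: continuous_set_typeP.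
  exact: (@set_val_continuous {ptws T -> R} (realization L)).
have cmu : continuous (fun x : polyhedron K => mu (set_val x)).
  apply: continuous_bigf => [f g|u]; first exact: continuous_minf.
  exact: polyhedron_eval_continuous.
have cret : continuous ret.
  apply: continuous_set_typeP; apply: continuous_ptwsP => u.
  apply: continuous_add; first exact: polyhedron_eval_continuous.
  apply: continuous_mul; last exact: cst_continuous.
  by apply: continuous_mul => //; exact: cst_continuous.
exists (incl p); apply: (@homotopic_trans _ _ _ _ (incl \o ret)); last first.
  exact: (homotopic_comp cret cincl hp).
exists (fun z => into z.2 (r z.1 (set_val z.2))); split => /=.
  apply: continuous_into => [[t x] /=|].
    by apply: rK (set_valP x); exact: unit_intervalP.
  have cx u : continuous (fun z : unit_interval R * polyhedron K => set_val z.2 u).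
    by apply: continuous_ptws_val; exact: snd_continuous.
  apply: continuous_ptwsP => u; apply: continuous_add => //.
  apply: continuous_mul; last exact: cst_continuous.
  apply: continuous_mul; first exact: fst_val_continuous.
  by apply: continuous_bigf => [f g|w]; [exact: continuous_minf|exact: cx].
split => x; apply: set_val_inj; rewrite intoE //.
- by apply/funext => u; rewrite /r !mul0r addr0.
- by apply: rK (set_valP x); rewrite lexx ler01.
- by apply: rK (set_valP x); rewrite lexx ler01.
Qed.

End realization.

(** * Attaching top-dimensional simplices *)

Section simplex_gauge.
Variables (R : realType) (d : nat).
Local Notation vec := ('I_d.+1 -> R).
Implicit Types (u w : vec) (a s : R).

Definition scl a u : vec := fun j => a * u j.

Definition sumzero u : Prop := \sum_j u j = 0.

(* Minkowski gauge, on vectors of sum zero, of the standard simplex centred at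
   its barycentre; the base value 0 of the maximum is then harmless. *)
Definition gauge u : R := \big[Num.max/0]_j (- (d.+1%:R * u j)).

(* Nonzero vectors are polar coordinates on the sphere: the first coordinate
   is the height, the others are read as the last coordinates of a vector of
   sum zero, which [hat] recovers. *)
Definition hat w : vec :=
  fun j => if j == ord0 then - \sum_(k | k != ord0) w k else w j.

Definition mkvec s u : vec := fun j => if j == ord0 then s else u j.

Lemma sumzero_hat w : sumzero (hat w).
Proof.
rewrite /sumzero (bigD1 ord0) //= {1}/hat eqxx.
rewrite [X in _ + X](eq_bigr w) ?addNr // => j /negPf j0.
by rewrite /hat j0.
Qed.

Lemma sumzero_scl a u : sumzero u -> sumzero (scl a u).
Proof. by rewrite /sumzero -mulr_sumr => ->; rewrite mulr0. Qed.

Lemma hat_mkvec s u : sumzero u -> hat (mkvec s u) = u.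
Proof.
rewrite /sumzero (bigD1 ord0) //= => /eqP; rewrite addr_eq0 => /eqP u0.
apply/funext => j; rewrite /hat /mkvec; case: eqP => [->|//].
by rewrite u0; congr (- _); apply: eq_bigr => k /negPf ->.
Qed.

Lemma mkvec_hat w : mkvec (w ord0) (hat w) = w.
Proof.
by apply/funext => j; rewrite /mkvec /hat; case: eqP => [->|].
Qed.

Lemma hat_scl a w : hat (scl a w) = scl a (hat w).
Proof.
apply/funext => j; rewrite /hat /scl; case: eqP => // _.
by rewrite mulrN mulr_sumr.
Qed.

Lemma gauge_ge0 u : 0 <= gauge u.
Proof. exact: bigmax_ge_id. Qed.

Lemma gauge_ge u j : - (d.+1%:R * u j) <= gauge u.
Proof. exact: (le_bigmax_cond _ (fun j => - (d.+1%:R * u j))). Qed.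

Lemma gauge_scl a u : 0 <= a -> gauge (scl a u) = a * gauge u.
Proof.
move=> a0; rewrite /gauge /scl.
elim/big_rec2: _ => [|j x y _ ->]; first by rewrite mulr0.
by rewrite maxr_pMr // mulrN mulrCA.
Qed.

(** Zero gauge leaves no negative coordinate, and nonnegative numbers of sum zero vanish. *)
Lemma gauge_eq0 u : sumzero u -> gauge u = 0 -> forall j, u j = 0.
Proof.
move=> su gu j; apply/eqP; have u0 k : 0 <= u k.
  have : - (d.+1%:R * u k) <= 0 by rewrite -[leRHS]gu gauge_ge.
  by rewrite oppr_le0 pmulr_rge0 // ltr0n.
have := psumr_eq0P (fun k _ => u0 k) su; by move=> ->.
Qed.

Lemma gauge_le1 u : (forall j, 0 <= d.+1%:R^-1 + u j) -> gauge u <= 1.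
Proof.
move=> uj; apply: bigmax_le => // j _; rewrite lerNl -(ler_pM2l (x := d.+1%:R^-1)).
  by rewrite mulKf ?pnatr_eq0// mulrN1 -subr_ge0 opprK addrC uj.
by rewrite invr_gt0 ltr0n.
Qed.

Lemma gauge_le1_ge0 u : gauge u <= 1 -> forall j, 0 <= d.+1%:R^-1 + u j.
Proof.
move=> gu j; have : - (d.+1%:R * u j) <= 1.
  by apply: le_trans gu; apply: gauge_ge.
rewrite -(ler_pM2l (x := d.+1%:R^-1)) ?invr_gt0 ?ltr0n //.
by rewrite mulrN mulKf ?pnatr_eq0// mulr1 -subr_ge0 opprK.
Qed.

Lemma gauge_ge1 u j : d.+1%:R^-1 + u j = 0 -> 1 <= gauge u.
Proof.
move=> /eqP; rewrite addrC addr_eq0 => /eqP uj.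
have : - (d.+1%:R * u j) <= gauge u by apply: gauge_ge.
by rewrite uj mulrN opprK divff ?pnatr_eq0.
Qed.

Lemma gauge_eq1 u : gauge u = 1 -> exists j, d.+1%:R^-1 + u j = 0.
Proof.
move=> gu; apply: contrapT => /forallNP nj; have : gauge u < 1.
  apply: bigmax_lt => // j _; rewrite lt_neqAle; apply/andP; split.
    apply/eqP => uj; apply: (nj j); have -> : u j = - d.+1%:R^-1; last by rewrite subrr.
    apply: (@mulfI _ d.+1%:R); first by rewrite pnatr_eq0.
    by apply: oppr_inj; rewrite uj mulrN opprK divff ?pnatr_eq0.
  by rewrite -[leRHS]gu gauge_ge.
by rewrite gu ltxx.
Qed.

Lemma gauge_hat_gt0 w : (exists2 j, j != ord0 & w j != 0) -> 0 < gauge (hat w).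
Proof.
move=> [j j0 wj]; rewrite lt_neqAle gauge_ge0 andbT; apply/eqP => /esym g0.
by have := gauge_eq0 (@sumzero_hat w) g0 j; rewrite /hat (negPf j0); apply/eqP.
Qed.

Lemma gauge_hat_eq0 w : gauge (hat w) = 0 -> forall j, j != ord0 -> w j = 0.
Proof.
move=> g0 j j0; have := gauge_eq0 (@sumzero_hat w) g0 j.
by rewrite /hat (negPf j0).
Qed.

Lemma vec_neq0 w : w ord0 != 0 \/ gauge (hat w) != 0 -> exists j, w j != 0.
Proof.
move=> [w0|gw]; first by exists ord0.
apply: contrapT => /forallNP nw; move: gw; rewrite /gauge.
rewrite bigmax_eq_id ?eqxx// => j _.
have w0 k : w k = 0 by apply/eqP/negPn/negP/nw.
rewrite /hat; case: eqP => _; rewrite ?w0 ?big1 ?oppr0 ?mulr0 ?oppr0 //.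
Qed.

Lemma gauge_hat_neq0 w : (exists j, w j != 0) -> w ord0 = 0 -> 0 < gauge (hat w).
Proof.
move=> [j wj] w0; apply: gauge_hat_gt0; exists j => //.
by apply: contraNneq wj => ->; rewrite w0.
Qed.

Definition euclid w : R := Num.sqrt (\sum_j w j ^+ 2).

Definition normalize w : vec := fun j => w j / euclid w.

Lemma euclid_gt0 w : (exists j, w j != 0) -> 0 < euclid w.
Proof.
move=> [j wj]; rewrite sqrtr_gt0 (bigD1 j) //= ltr_pwDl //.
  by rewrite exprn_even_gt0.
by apply: sumr_ge0 => k _; exact: sqr_ge0.
Qed.

Lemma normalize_sphere w : (exists j, w j != 0) ->
  sphere R d (normalize w : {ptws 'I_d.+1 -> R}).
Proof.
move=> w0; have e0 := euclid_gt0 w0; rewrite /sphere /= /normalize.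
under eq_bigr do rewrite exprMn exprVn.
rewrite -mulr_suml sqr_sqrtr ?divff //; last first.
  by apply: sumr_ge0 => k _; exact: sqr_ge0.
by move: e0; rewrite sqrtr_gt0 => /lt0r_neq0.
Qed.

Lemma sphere_neq0 w : sphere R d (w : {ptws 'I_d.+1 -> R}) -> exists j, w j != 0.
Proof.
rewrite /sphere /= => w1; apply: contrapT => /forallNP nw.
have : \sum_j w j ^+ 2 = 0.
  by apply: big1 => j _; rewrite (_ : w j = 0) ?expr0n //; apply/eqP/negPn/negP/nw.
by rewrite w1 => /eqP; rewrite oner_eq0.
Qed.

Lemma normalize_id w : sphere R d (w : {ptws 'I_d.+1 -> R}) -> normalize w = w.
Proof.
rewrite /sphere /= /normalize /euclid => ->; rewrite sqrtr1.
by apply/funext => j; rewrite divr1.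
Qed.

Lemma normalize_scl a w : 0 < a -> normalize (scl a w) = normalize w.
Proof.
move=> a0; apply/funext => j; rewrite /normalize /scl.
have -> : euclid (fun j => a * w j) = a * euclid w.
  rewrite /euclid; under eq_bigr do rewrite exprMn.
  by rewrite -mulr_sumr sqrtrM ?sqr_ge0 // sqrtr_sqr gtr0_norm.
by rewrite invfM mulrACA divff ?mul1r // gt_eqF.
Qed.

Lemma normalize_mkvec0 a : 0 < a ->
  normalize (mkvec a (fun=> 0)) = (sphere_pt_fun R d : vec).
Proof.
move=> a0; have -> : mkvec a (fun=> 0) = scl a (sphere_pt_fun R d).
  apply/funext => j; rewrite /mkvec /scl /sphere_pt_fun.
  by case: eqP => _; rewrite ?mulr1 ?mulr0.
rewrite normalize_scl // normalize_id //.
by have := sphere_pt_in R d; rewrite inE.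
Qed.

Section continuity.
Variable Z : topologicalType.
Implicit Types f : Z -> vec.

Definition vcontinuous f := forall j, continuous (fun z => f z j).

Lemma vcontinuous_hat f : vcontinuous f -> vcontinuous (fun z => hat (f z)).
Proof.
move=> cf j; rewrite /hat; case: eqP => // _; apply: continuous_opp.
apply: continuous_bigf => [g h|k]; [exact: continuous_add|exact: cf].
Qed.

Lemma vcontinuous_mkvec (s : Z -> R) f : continuous s -> vcontinuous f ->
  vcontinuous (fun z => mkvec (s z) (f z)).
Proof. by move=> cs cf j; rewrite /mkvec; case: eqP. Qed.

Lemma vcontinuous_scl (s : Z -> R) f : continuous s -> vcontinuous f ->
  vcontinuous (fun z => scl (s z) (f z)).
Proof. by move=> cs cf j; apply: continuous_mul. Qed.

Lemma continuous_gauge f : vcontinuous f -> continuous (fun z => gauge (f z)).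
Proof.
move=> cf; apply: continuous_bigf => [g h|j]; first exact: continuous_maxf.
apply: continuous_opp; apply: continuous_mul => //; exact: cst_continuous.
Qed.

Lemma vcontinuous_normalize f : (forall z, exists j, f z j != 0) ->
  vcontinuous f -> vcontinuous (fun z => normalize (f z)).
Proof.
move=> f0 cf j; apply: continuous_div => // [z|].
  by rewrite gt_eqF // euclid_gt0.
apply: continuous_sqrt; apply: continuous_bigf => [g h|k].
  exact: continuous_add.
by under eq_fun do rewrite expr2; apply: continuous_mul.
Qed.

End continuity.

End simplex_gauge.

(** * Facets glued to a contractible complex *)

Section facets.
Variables (R : realType) (T : finType) (K : pred {set T}) (m d : nat).
Variable e : 'I_m -> 'I_d.+1 -> T.
Local Notation vec := ('I_d.+1 -> R).
Implicit Types (i : 'I_m) (j : 'I_d.+1) (u w : vec) (x : {ptws T -> R}).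

Definition facet i : {set T} := finset (fun v => [exists j, v == e i j]).

(** Only the open facets are removed; their boundaries remain. *)
Definition open_skeleton : pred {set T} :=
  fun G => K G && [forall i, G != facet i].

Local Notation L := open_skeleton.

Hypothesis dK : downclosed K.
Hypothesis e_inj : forall i, injective (e i).
Hypothesis facetK : forall i, K (facet i).
Hypothesis facet_max : forall i G, K G -> facet i \subset G -> G = facet i.
Hypothesis facet_inj : injective facet.

(** Here [u] is the displacement from the barycentre of the facet; [coord] is the inverse. *)
Definition pt i u : {ptws T -> R} :=
  fun v => \sum_j (v == e i j)%:R * (d.+1%:R^-1 + u j).

Definition coord i x : vec := fun j => x (e i j) - d.+1%:R^-1.

Lemma in_facet i j : e i j \in facet i.
Proof. by rewrite inE; apply/existsP; exists j. Qed.

Lemma pt_e i u j : pt i u (e i j) = d.+1%:R^-1 + u j.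
Proof.
rewrite /pt (bigD1 j) //= eqxx mul1r big1 ?addr0 // => k kj.
by rewrite (inj_eq (@e_inj i)) eq_sym (negPf kj) mul0r.
Qed.

Lemma pt_out i u v : v \notin facet i -> pt i u v = 0.
Proof.
rewrite inE => /existsPn nv; apply: big1 => j _.
by rewrite (negPf (nv j)) mul0r.
Qed.

Lemma supp_pt i u : supp (pt i u) \subset facet i.
Proof.
by apply/fintype.subsetP => v; rewrite in_supp; apply: contraNT => /pt_out ->.
Qed.

Lemma sum_pt i u : sumzero u -> \sum_v pt i u v = 1.
Proof.
move=> su; rewrite /pt exchange_big /= (eq_bigr (fun j => d.+1%:R^-1 + u j)); last first.
  move=> j _; rewrite -mulr_suml (bigD1 (e i j)) //= eqxx big1 ?addr0 ?mul1r //.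
  by move=> v /negPf ->.
rewrite big_split /= su addr0 sumr_const card_ord.
by rewrite -[d.+1%:R^-1 *+ d.+1]mulr_natr mulVf ?pnatr_eq0.
Qed.

Lemma coord_pt i u : coord i (pt i u) = u.
Proof. by apply/funext => j; rewrite /coord pt_e addrC addKr. Qed.

Lemma supp_out x i v : supp x \subset facet i -> v \notin facet i -> x v = 0.
Proof.
move=> xi; apply: contraNeq => xv; apply: (fintype.subsetP xi).
by rewrite in_supp.
Qed.

Lemma pt_coord i x : supp x \subset facet i -> pt i (coord i x) = x.
Proof.
move=> xi; apply/funext => v; have [|vi] := boolP (v \in facet i); last first.
  by rewrite pt_out // (supp_out xi).
by rewrite inE => /existsP[j /eqP ->]; rewrite pt_e /coord addrC subrK.
Qed.

Lemma sumzero_coord i x : realization K x -> supp x \subset facet i ->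
  sumzero (coord i x).
Proof.
move=> Kx xi; have [_ [x1 _]] := Kx; rewrite -(pt_coord xi) in x1.
rewrite /sumzero; apply: (@addrI _ 1); rewrite addr0 -[RHS]x1 /pt exchange_big /=.
rewrite [RHS](eq_bigr (fun j => d.+1%:R^-1 + coord i x j)); last first.
  move=> j _; rewrite -mulr_suml (bigD1 (e i j)) //= eqxx big1 ?addr0 ?mul1r //.
  by move=> v /negPf ->.
rewrite [RHS]big_split /= sumr_const card_ord.
by rewrite -[d.+1%:R^-1 *+ d.+1]mulr_natr mulVf ?pnatr_eq0.
Qed.

Lemma gauge_coord_le1 i x : realization K x -> gauge (coord i x) <= 1.
Proof.
by move=> [x0 _]; apply: gauge_le1 => j; rewrite /coord addrC subrK.
Qed.

Lemma gauge_coord_eq1 i x : realization K x ->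
  ~~ (facet i \subset supp x) -> gauge (coord i x) = 1.
Proof.
move=> Kx /subsetPn[v]; rewrite inE => /existsP[j /eqP ->].
rewrite in_supp negbK => /eqP xj.
apply/eqP; rewrite eq_le gauge_coord_le1 //=; apply: (@gauge_ge1 _ _ _ j).
by rewrite /coord xj sub0r subrr.
Qed.

Lemma pt_realization i u : sumzero u -> gauge u <= 1 -> realization K (pt i u).
Proof.
move=> su gu; split => [v|].
  have [|vi] := boolP (v \in facet i); last by rewrite pt_out.
  rewrite inE => /existsP[j /eqP ->]; rewrite pt_e; exact: gauge_le1_ge0.
split; first exact: sum_pt.
exact: dK (supp_pt i u) (facetK i).
Qed.

Lemma realization_skeleton x : realization K x ->
  (forall i, ~~ (facet i \subset supp x)) -> realization L x.
Proof.
move=> [x0 [x1 Kx]] nx; split=> //; split=> //; rewrite /open_skeleton Kx /=.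
by apply/forallP => i; apply: contraNneq (nx i) => E; rewrite -E.
Qed.

Lemma facet_subset x i i' : realization K x -> supp x \subset facet i ->
  facet i' \subset supp x -> i' = i.
Proof.
move=> [_ [_ Kx]] xi i'x; apply: facet_inj; apply/eqP; rewrite finset.eqEsubset.
rewrite (fintype.subset_trans i'x xi) /=.
by rewrite (facet_max (facetK i) (fintype.subset_trans i'x xi)).
Qed.

Lemma pt_skeleton i u : sumzero u -> gauge u = 1 -> realization L (pt i u).
Proof.
move=> su gu; have Ku : realization K (pt i u) by apply: pt_realization => //; rewrite gu.
apply: realization_skeleton => // i'; apply/negP => i'u.
have E := facet_subset Ku (supp_pt i u) i'u; rewrite {}E in i'u.
have [j uj] := gauge_eq1 gu.
by have := fintype.subsetP i'u _ (in_facet i j); rewrite in_supp pt_e uj eqxx.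
Qed.

Lemma skeleton_subset x i : realization L x -> ~~ (facet i \subset supp x).
Proof.
move=> [_ [_ /andP[Kx /forallP /(_ i)]]]; apply: contraNN => ix.
by apply/eqP; exact: facet_max.
Qed.

Variable pL : polyhedron R L.
Variable H : R * polyhedron R L -> polyhedron R L.
Hypothesis cH :
  continuous (fun p : unit_interval R * polyhedron R L => H (set_val p.1, p.2)).
Hypothesis H0 : forall y, H (0, y) = y.
Hypothesis H1 : forall y, H (1, y) = pL.

Lemma skeleton_realization x : realization L x -> realization K x.
Proof. by apply: realization_sub => G /andP[]. Qed.

Definition incl (y : polyhedron R L) : polyhedron R K :=
  exist _ (set_val y) (mem_set (skeleton_realization (set_valP y))).

Lemma incl_val y : set_val (incl y) = set_val y.
Proof. by []. Qed.

Lemma incl_continuous : continuous incl.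
Proof.
apply: continuous_set_typeP.
exact: (@set_val_continuous {ptws T -> R} (realization L)).
Qed.

(* The lower hemisphere parametrizes the facet radially; above the equator the
   null-homotopy of the skeleton is run, with time the slope, so that a whole
   neighbourhood of the base point goes to [pL]. *)
Definition cell i w : polyhedron R K :=
  let g := gauge (hat w) in
  if w ord0 <= 0 then into (incl pL) (pt i (scl (g - w ord0)^-1 (hat w)))
  else if w ord0 <= g then incl (H (w ord0 / g, into pL (pt i (scl g^-1 (hat w)))))
  else incl pL.

Lemma cell_bottom i w : w ord0 <= 0 ->
  cell i w = into (incl pL) (pt i (scl (gauge (hat w) - w ord0)^-1 (hat w))).
Proof. by rewrite /cell => ->. Qed.

Lemma cell_denom w : (exists j, w j != 0) -> w ord0 <= 0 ->
  0 < gauge (hat w) - w ord0.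
Proof.
move=> nw w0; have g0 := gauge_ge0 (hat w).
have [E|w0'] := eqVneq (w ord0) 0.
  by rewrite E subr0; exact: gauge_hat_neq0.
by rewrite ltr_wpDl // oppr_gt0 lt_neqAle w0'.
Qed.

Lemma cell_bottom_realization i w : (exists j, w j != 0) -> w ord0 <= 0 ->
  realization K (pt i (scl (gauge (hat w) - w ord0)^-1 (hat w))).
Proof.
move=> nw w0; have D := cell_denom nw w0.
apply: pt_realization; first exact/sumzero_scl/sumzero_hat.
rewrite gauge_scl ?invr_ge0 ?(ltW D) // mulrC ler_pdivrMr // mul1r.
by rewrite lerDl oppr_ge0.
Qed.

Lemma cell_equator_realization i w : 0 < gauge (hat w) ->
  realization L (pt i (scl (gauge (hat w))^-1 (hat w))).
Proof.
move=> g0; apply: pt_skeleton; first exact/sumzero_scl/sumzero_hat.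
by rewrite gauge_scl ?invr_ge0 ?(ltW g0) // mulVf // gt_eqF.
Qed.

(** At height zero this is the gluing along the equator: [H] starts at the identity, and the lower
    formula has gauge 1 there. *)
Lemma cell_middle i w : (exists j, w j != 0) -> 0 <= w ord0 <= gauge (hat w) ->
  0 < gauge (hat w) /\
  cell i w = incl (H (w ord0 / gauge (hat w),
                      into pL (pt i (scl (gauge (hat w))^-1 (hat w))))).
Proof.
move=> nw /andP[w0 wg]; have g0 : 0 < gauge (hat w).
  have [E|w0'] := eqVneq (w ord0) 0; first exact: gauge_hat_neq0.
  by apply: lt_le_trans wg; rewrite lt_neqAle eq_sym w0'.
split => //; rewrite /cell wg; case: ifP => // w0'.
have E : w ord0 = 0 by apply/eqP; rewrite eq_le w0 w0'.
rewrite E subr0 mul0r H0; apply: set_val_inj.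
have Lw := cell_equator_realization i g0.
by rewrite incl_val !intoE //; exact: skeleton_realization.
Qed.

(** At slope one this is the upper gluing, where [H] has arrived at [pL]. *)
Lemma cell_top i w : (exists j, w j != 0) -> gauge (hat w) <= w ord0 ->
  cell i w = incl pL.
Proof.
move=> nw gw; have g0 := gauge_ge0 (hat w).
have w0 : 0 < w ord0.
  rewrite lt_neqAle (le_trans g0 gw) andbT eq_sym; apply/eqP => w0.
  by have := gauge_hat_neq0 nw w0; rewrite ltNge -w0 gw.
rewrite /cell leNgt w0 /=; case: ifP => // wg.
have -> : gauge (hat w) = w ord0 by apply/eqP; rewrite eq_le wg gw.
by rewrite divff ?gt_eqF // H1.
Qed.

(** The slope and the argument of [pt] are homogeneous of degree zero, so [cell] depends only on the
    direction and can be applied to vectors that are not normalized. *)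
Lemma cell_scl i a w : (exists j, w j != 0) -> 0 < a -> cell i (scl a w) = cell i w.
Proof.
move=> nw a0; rewrite /cell hat_scl gauge_scl ?(ltW a0) //.
have -> : scl a w ord0 = a * w ord0 by [].
rewrite pmulr_rle0 // ler_pM2l //.
have S b : scl (a * b)^-1 (scl a (hat w)) = scl b^-1 (hat w).
  apply/funext => j; rewrite /scl mulrA; congr (_ * _).
  by rewrite invfM mulrAC mulVf ?mul1r // gt_eqF.
case: ifP => [w0|_]; first by rewrite -mulrBr S.
case: ifP => // wg; congr (incl (H (_, _))); last by rewrite S.
by rewrite invfM mulrACA divff ?mul1r // gt_eqF.
Qed.

Lemma pt_continuous (Z : topologicalType) (f : Z -> vec) i :
  vcontinuous f -> continuous (fun z => pt i (f z)).
Proof.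
move=> cf; apply: continuous_ptwsP => v.
apply: continuous_bigf => [g h|j]; first exact: continuous_add.
apply: continuous_mul; first exact: cst_continuous.
by apply: continuous_add => //; exact: cst_continuous.
Qed.

Lemma cell_continuous (Z : topologicalType) (f : Z -> vec) i :
    (forall z, exists j, f z j != 0) -> vcontinuous f ->
  continuous (fun z => cell i (f z)).
Proof.
move=> f0 cf.
pose g z := gauge (hat (f z)).
have cg : continuous g by exact/continuous_gauge/vcontinuous_hat.
pose C (k : option bool) : set Z := match k with
  | None => [set z | g z <= f z ord0]
  | Some true => [set z | f z ord0 <= 0]
  | Some false => [set z | 0 <= f z ord0] `&` [set z | f z ord0 <= g z]
  end.
have cst0 (c : R) : continuous (fun _ : Z => c) by exact: cst_continuous.
have cs k : continuous (set_val : set_type (C k) -> Z) by exact: set_val_continuous.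
have cfk k : vcontinuous (fun z : set_type (C k) => f (set_val z)).
  by move=> j; apply: continuous_comp_fun (cf j) (cs k).
have cgk k : continuous (fun z : set_type (C k) => g (set_val z)).
  by apply: continuous_comp_fun cg (cs k).
apply: (@continuous_paste _ _ _ C) => [[[]|]|z|[[]|]].
- exact: closed_le_fun.
- by apply: closedI; exact: closed_le_fun.
- exact: closed_le_fun.
- have [?|/ltW ?] := leP (f z ord0) 0; first by exists (Some true).
  by have [?|/ltW ?] := leP (f z ord0) (g z); [exists (Some false)|exists None].
- have w0 (z : set_type (C (Some true))) : f (set_val z) ord0 <= 0.
    exact: (set_valP z : C (Some true) (set_val z)).
  rewrite (_ : _ \o _ = fun z : set_type (C (Some true)) => into (incl pL)
    (pt i (scl (g (set_val z) - f (set_val z) ord0)^-1 (hat (f (set_val z)))))); last first.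
    by apply/funext => z /=; rewrite cell_bottom.
  apply: continuous_into => [z|]; first exact: cell_bottom_realization.
  apply/pt_continuous/vcontinuous_scl; last exact: vcontinuous_hat.
  apply: continuous_inv => [z|]; first by rewrite gt_eqF // cell_denom.
  by apply: continuous_sub; [exact: cgk|exact: cfk].
- have w0 (z : set_type (C (Some false))) :
      0 <= f (set_val z) ord0 <= g (set_val z).
    by apply/andP; exact: (set_valP z : C (Some false) (set_val z)).
  have g0 (z : set_type (C (Some false))) : 0 < g (set_val z).
    by have [] := cell_middle i (f0 _) (w0 z).
  rewrite (_ : _ \o _ = fun z : set_type (C (Some false)) => incl
      (H (f (set_val z) ord0 / g (set_val z),
        into pL (pt i (scl (g (set_val z))^-1 (hat (f (set_val z)))))))); last first.
    by apply/funext => z /=; have [] := cell_middle i (f0 _) (w0 z).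
  apply: (continuous_comp_fun incl_continuous).
  apply: (homotopy_comp_continuous cH) => [z||].
  + have /andP[w1 w2] := w0 z; apply/andP; split.
      by apply: divr_ge0 => //; exact: ltW.
    by rewrite ler_pdivrMr // mul1r.
  + apply: continuous_div => [z||]; [by rewrite gt_eqF|exact: cfk|exact: cgk].
  + apply: continuous_into => [z|]; first exact: cell_equator_realization (g0 z).
    apply/pt_continuous/vcontinuous_scl; last exact: vcontinuous_hat.
    by apply: continuous_inv => [z|]; [rewrite gt_eqF|exact: cgk].
- rewrite (_ : _ \o _ = fun=> incl pL); first exact: cst_continuous.
  apply/funext => z /=; apply: cell_top => //.
  exact: (set_valP z : C None (set_val z)).
Qed.

(** The closed facets and the remaining complex form a finite closed cover, pulled back along [k] so
    that it also serves on products with the interval. *)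
Lemma facet_paste (Z Y : topologicalType) (k : Z -> polyhedron R K) (f : Z -> Y) :
    continuous k ->
    (forall i, continuous (f \o (set_val :
      set_type [set z | supp (set_val (k z)) \subset facet i] -> Z))) ->
    continuous (f \o (set_val :
      set_type [set z | realization L (set_val (k z))] -> Z)) ->
  continuous f.
Proof.
move=> ck cf cL.
have ckv v : continuous (fun z => set_val (k z) v) by exact: continuous_ptws_val.
have k0 z v : 0 <= set_val (k z) v.
  by have [+ _] : realization K (set_val (k z)) := set_valP (k z); apply.
pose C (o : option 'I_m) : set Z := if o is Some i
  then [set z | supp (set_val (k z)) \subset facet i]
  else [set z | realization L (set_val (k z))].
apply: (@continuous_paste _ _ _ C) => [[i|]|z|[i|]] //.
(* Coordinates are nonnegative, so a support in the facet is the closed condition that the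
   coordinates outside it have sum at most 0. *)
- rewrite (_ : C _ = [set z | \sum_(v | v \notin facet i) set_val (k z) v <= 0]).
    apply: closed_le_fun; last exact: cst_continuous.
    by apply: continuous_bigf => // g h; exact: continuous_add.
  rewrite eqEsubset; split => z /=.
    by move=> zi; rewrite big1 // => v vi; exact: supp_out vi.
  move=> z0; apply/fintype.subsetP => v; rewrite in_supp; apply: contraNT => vi.
  have s0 : \sum_(v | v \notin facet i) set_val (k z) v = 0.
    by apply/eqP; rewrite eq_le z0 sumr_ge0.
  by apply/eqP; exact: (psumr_eq0P _ s0).
(* A point avoids all open facets iff on each facet some coordinate vanishes, that is, iff every
   product is zero. *)
- rewrite (_ : C _ = [set z | \sum_i \prod_j set_val (k z) (e i j) <= 0]).
    apply: closed_le_fun; last exact: cst_continuous.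
    apply: continuous_bigf => [g h|i]; first exact: continuous_add.
    by apply: continuous_bigf => [g h|j] //; exact: continuous_mul.
  have P i z : 0 <= \prod_j set_val (k z) (e i j) by exact: prodr_ge0.
  rewrite eqEsubset; split => z /=.
    move=> zL; rewrite big1 // => i _; have /subsetPn[v] := skeleton_subset i zL.
    rewrite inE => /existsP[j /eqP ->]; rewrite in_supp negbK => /eqP xj.
    by rewrite (bigD1 j) //= xj mul0r.
  move=> z0; apply: realization_skeleton; first exact: set_valP.
  move=> i; have s0 : \sum_i \prod_j set_val (k z) (e i j) = 0.
    by apply/eqP; rewrite eq_le z0 sumr_ge0.
  have /eqP : \prod_j set_val (k z) (e i j) = 0.
    by apply: (psumr_eq0P _ s0) => // i' _; exact: P.
  move=> /prodf_eq0[j _ xj]; apply/subsetPn; exists (e i j); first exact: in_facet.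
  by rewrite in_supp negbK.
- have Kz : realization K (set_val (k z)) := set_valP (k z).
  have [/existsP[i iz]|/existsPn nz] := boolP [exists i, facet i \subset supp (set_val (k z))].
    exists (Some i) => /=; have [_ [_ Kx]] := Kz.
    by rewrite -(facet_max Kx iz).
  by exists None; apply: realization_skeleton.
- exact: cf.
Qed.

(** * The quotient map to the wedge, the attaching map and the two homotopies *)

Variable i0 : 'I_m.
Local Notation W := (wedge_spheres R m d).
Local Notation S := (set_type (sphere R d)).

Definition lift i (p : S) : W :=
  @wedge_lift 'I_m (fun _ => S) (fun _ => sphere_pt R d) i p.

Definition base : W := lift i0 (sphere_pt R d).

Lemma sphere_pt_val : set_val (sphere_pt R d) = sphere_pt_fun R d.
Proof. by []. Qed.

Lemma lift_base i : lift i (sphere_pt R d) = base.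
Proof.
exact: (@wedge_liftE _ _ (fun _ : 'I_m => sphere_pt R d) i0 (sphere_pt R d)
  i (sphere_pt R d)).
Qed.

Lemma lift_continuous i : continuous (lift i).
Proof.
exact: (@wedge_lift_continuous 'I_m (fun _ => S : topologicalType)
  (fun _ => sphere_pt R d) i).
Qed.

Lemma liftP (y : W) : exists i p, y = lift i p.
Proof.
have : [set: W] y by [].
by rewrite -(@wedgeTE _ _ (fun _ : 'I_m => sphere_pt R d)) => -[i _ [p _ <-]]; exists i, p.
Qed.

Definition dir w : S := into (sphere_pt R d) (normalize w : {ptws 'I_d.+1 -> R}).

Lemma dir_continuous (Z : topologicalType) (f : Z -> vec) :
  (forall z, exists j, f z j != 0) -> vcontinuous f ->
  continuous (fun z => dir (f z)).
Proof.
move=> f0 cf; apply: continuous_into => [z|]; first exact: normalize_sphere.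
apply: continuous_ptwsP; exact: vcontinuous_normalize.
Qed.

Lemma dir_base a : 0 < a -> dir (mkvec a (fun=> 0)) = sphere_pt R d.
Proof.
move=> a0; apply: set_val_inj; rewrite /dir normalize_mkvec0 // intoE //.
by have := sphere_pt_in R d; rewrite inE.
Qed.

(* [path 0 i x] are polar coordinates of [x] in the facet, [path 1 i x] those of
   its image in the sphere, where the boundary of the facet is collapsed. *)
Definition path (t : R) i x : vec :=
  let u := coord i x in let n := gauge u in
  mkvec ((1 - t) * (n - 1) + t * (2 * n - 1)) (scl (1 - t * n) u).

Section path.
Variables (t : R) (i : 'I_m) (x : {ptws T -> R}).
Hypotheses (t01 : 0 <= t <= 1) (Kx : realization K x) (xi : supp x \subset facet i).
Let u := coord i x.
Let n := gauge u.

Lemma path_coef : 0 <= 1 - t * n.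
Proof.
have n1 : n <= 1 by exact: gauge_coord_le1.
have n0 : 0 <= n by exact: gauge_ge0.
move/andP: t01 => [t0 t1]; rewrite subr_ge0; exact: mulr_ile1.
Qed.

Lemma hat_path : hat (path t i x) = scl (1 - t * n) u.
Proof. by rewrite /path hat_mkvec //; exact/sumzero_scl/sumzero_coord. Qed.

Lemma gauge_path : gauge (hat (path t i x)) = (1 - t * n) * n.
Proof. by rewrite hat_path gauge_scl // path_coef. Qed.

Lemma path_ord0 : path t i x ord0 = (1 - t) * (n - 1) + t * (2 * n - 1).
Proof. by rewrite /path /mkvec eqxx. Qed.

(** Height and radius never vanish together: for n = 0 the height is -1, and t n = 1 forces t = n =
    1, where the height is 1. *)
Lemma path_neq0 : exists j, path t i x j != 0.
Proof.
apply: vec_neq0; rewrite gauge_path path_ord0.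
have n1 : n <= 1 by exact: gauge_coord_le1.
have n0 : 0 <= n by exact: gauge_ge0.
have [E|nn0] := eqVneq n 0; first by left; rewrite E !mulr0; apply/eqP; lra.
have [E|] := eqVneq ((1 - t * n) * n) 0; last by right.
left; move/eqP: E; rewrite mulf_eq0 (negPf nn0) orbF subr_eq0 => /eqP E.
move/andP: t01 => [t0 t1].
have t1' : t = 1 by apply/eqP; rewrite eq_le t1 /= E ler_piMr.
by move: E; rewrite t1' mul1r => <-; rewrite subrr mul0r add0r mul1r mulr1; apply/eqP; lra.
Qed.

End path.

Lemma path_continuous (Z : topologicalType) (t : Z -> R) (k : Z -> polyhedron R K) i :
  continuous t -> continuous k ->
  vcontinuous (fun z => path (t z) i (set_val (k z))).
Proof.
move=> ct ck; have cc : vcontinuous (fun z => coord i (set_val (k z))).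
  move=> j; apply: continuous_sub; last exact: cst_continuous.
  exact: continuous_ptws_val.
have cn := continuous_gauge cc.
have cst (c : R) : continuous (fun _ : Z => c) by exact: cst_continuous.
apply: vcontinuous_mkvec.
  by apply: continuous_add; apply: continuous_mul => //; apply: continuous_sub => //;
    apply: continuous_mul.
apply: vcontinuous_scl => //; apply: continuous_sub => //; exact: continuous_mul.
Qed.

Lemma path_boundary t i x : realization K x ->
  supp x \subset facet i -> ~~ (facet i \subset supp x) ->
  path t i x = mkvec t (scl (1 - t) (coord i x)).
Proof.
move=> Kx xi ix; rewrite /path gauge_coord_eq1 // !mulr1 subrr mulr0 add0r.
by rewrite (_ : 2 - 1 = 1) ?mulr1 //; lra.
Qed.

Definition quot (x : polyhedron R K) : W :=
  if [pick i | facet i \subset supp (set_val x)] is Some i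
  then lift i (dir (path 1 i (set_val x))) else base.

Lemma one_itv01 : 0 <= (1 : R) <= 1. Proof. by rewrite lexx ler01. Qed.

(** On the boundary of the facet the gauge is 1 and the formula yields the pole, in agreement with
    [base]. *)
Lemma quot_facet i (x : polyhedron R K) : supp (set_val x) \subset facet i ->
  quot x = lift i (dir (path 1 i (set_val x))).
Proof.
move=> xi; have Kx : realization K (set_val x) := set_valP x.
rewrite /quot; case: pickP => [i' i'x|/(_ i)/negbT nx].
  by rewrite (facet_subset Kx xi i'x).
rewrite path_boundary // subrr.
rewrite (_ : scl 0 _ = fun=> 0); last by apply/funext => j; rewrite /scl mul0r.
by rewrite dir_base // lift_base.
Qed.

Lemma quot_skeleton (x : polyhedron R K) : realization L (set_val x) -> quot x = base.
Proof.
move=> Lx; rewrite /quot; case: pickP => // i ix.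
by have := skeleton_subset i Lx; rewrite ix.
Qed.

Lemma quot_continuous : continuous quot.
Proof.
apply: (@facet_paste _ _ id) => [x|i|]; first exact: cvg_id.
  rewrite (_ : _ \o _ = lift i \o (fun z : set_type
     [set z : polyhedron R K | supp (set_val z) \subset facet i] =>
     dir (path 1 i (set_val (set_val z))))); last first.
    by apply/funext => z /=; apply: quot_facet; exact: (set_valP z).
  apply: (continuous_comp_fun (@lift_continuous i)); apply: dir_continuous => [z|].
    by apply: (path_neq0 one_itv01 (set_valP _)); exact: (set_valP z).
  by apply: path_continuous; [exact: cst_continuous|exact: set_val_continuous].
rewrite (_ : _ \o _ = fun=> base); first exact: cst_continuous.
by apply/funext => z /=; apply: quot_skeleton; exact: (set_valP z).
Qed.

Definition attach : W -> polyhedron R K :=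
  @wedge_fun 'I_m (fun _ => S) (fun _ => sphere_pt R d) _ (fun i p => cell i (set_val p)).

Lemma cell_base i : cell i (sphere_pt_fun R d) = incl pL.
Proof.
have nw : exists j, (sphere_pt_fun R d : vec) j != 0.
  by exists ord0; rewrite /sphere_pt_fun eqxx oner_eq0.
apply: cell_top => //; rewrite (_ : sphere_pt_fun R d = mkvec 1 (fun=> 0)).
  rewrite hat_mkvec ?/sumzero ?big1 //.
  by rewrite /gauge bigmax_eq_id /mkvec ?eqxx ?ler01 // => j _; rewrite mulr0 oppr0.
by apply/funext => j; rewrite /mkvec /sphere_pt_fun; case: eqP.
Qed.

Lemma attach_lift i (p : S) : attach (lift i p) = cell i (set_val p).
Proof.
rewrite /attach /lift wedge_lift_funE // => i' i''.
by rewrite !sphere_pt_val !cell_base.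
Qed.

Lemma sphere_vcontinuous : vcontinuous (fun p : S => (set_val p : vec)).
Proof. by move=> j; apply: continuous_ptws_val => p; exact: cvg_id. Qed.

Lemma attach_continuous : continuous attach.
Proof.
apply: wedge_fun_continuous => [i|i' i'']; last first.
  by rewrite !sphere_pt_val !cell_base.
apply: cell_continuous => [p|]; last exact: sphere_vcontinuous.
exact: sphere_neq0 (set_valP p).
Qed.

(** On the boundary of a facet [path t] has height t and gauge 1 - t. There [cell] runs [H] at time
    t / (1 - t) until t = 1/2 and then rests at [pL]; the time t / max(t, 1 - t) on the skeleton is
    chosen to agree with this. *)
Definition stretch (z : R * polyhedron R K) : polyhedron R K :=
  if [pick i | facet i \subset supp (set_val z.2)] is Some i
  then cell i (path z.1 i (set_val z.2))
  else incl (H (z.1 / Num.max z.1 (1 - z.1), into pL (set_val z.2))).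

Lemma ratio01 (t : R) : 0 <= t <= 1 ->
  0 < Num.max t (1 - t) /\ 0 <= t / Num.max t (1 - t) <= 1.
Proof.
move=> /andP[t0 t1]; have M0 : 0 < Num.max t (1 - t).
  by rewrite lt_max; have [//|t0'] := ltP 0 t; apply/orP; right; lra.
split => //; rewrite divr_ge0 ?(ltW M0) //= ler_pdivrMr // mul1r.
by rewrite le_max lexx.
Qed.

Lemma stretch_skeleton t (x : polyhedron R K) : realization L (set_val x) ->
  stretch (t, x) = incl (H (t / Num.max t (1 - t), into pL (set_val x))).
Proof.
move=> Lx; rewrite /stretch /=; case: pickP => // i ix.
by have := skeleton_subset i Lx; rewrite ix.
Qed.

Lemma sclK a u : a != 0 -> scl a^-1 (scl a u) = u.
Proof. by move=> a0; apply/funext => j; rewrite /scl mulKf. Qed.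

Lemma stretch_facet i t (x : polyhedron R K) : 0 <= t <= 1 ->
  supp (set_val x) \subset facet i ->
  stretch (t, x) = cell i (path t i (set_val x)).
Proof.
move=> t01 xi; have Kx : realization K (set_val x) := set_valP x.
rewrite /stretch /=; case: pickP => [i' i'x|/(_ i)/negbT nx].
  by rewrite (facet_subset Kx xi i'x).
have nw := path_neq0 t01 Kx xi; have gw := gauge_path t01 Kx xi.
have hw := hat_path t Kx xi.
move: nw gw hw; rewrite path_boundary // gauge_coord_eq1 // !mulr1.
set w := mkvec _ _ => nw gw hw.
have wt : w ord0 = t by rewrite /w /mkvec eqxx.
have [t0 t1] := andP t01; have [tt|tt] := leP t (1 - t).
  have wg : 0 <= w ord0 <= gauge (hat w) by rewrite wt gw t0.
  have [g0 ->] := cell_middle i nw wg.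
  rewrite gw wt hw sclK ?pt_coord // -?gw ?gt_eqF //.
rewrite cell_top ?gw ?wt ?(ltW tt) // divff ?H1 //.
by apply: lt0r_neq0; lra.
Qed.

Lemma stretch_homotopy :
  homotopic R (polyhedron R K) (polyhedron R K) idfun (attach \o quot).
Proof.
exists stretch; split.
  pose I01 := unit_interval R.
  have cx : continuous (fun p : I01 * polyhedron R K => p.2) by exact: snd_continuous.
  have ct := @fst_val_continuous R (polyhedron R K).
  apply: (facet_paste cx) => [i|].
    pose C := [set z : I01 * polyhedron R K | supp (set_val z.2) \subset facet i].
    have cv : continuous (set_val : set_type C -> _) by exact: set_val_continuous.
    have zC (z : set_type C) : supp (set_val (set_val z).2) \subset facet i.
      exact: (set_valP z : C (set_val z)).
    rewrite (_ : _ \o _ = fun z : set_type C =>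
      cell i (path (set_val (set_val z).1) i (set_val (set_val z).2))); last first.
      apply/funext => z /=; apply: stretch_facet => //; exact: unit_intervalP.
    apply: cell_continuous => [z|].
      exact: (path_neq0 (unit_intervalP (set_val z).1) (set_valP (set_val z).2) (zC z)).
    apply: path_continuous; first exact: (continuous_comp_fun ct cv).
    exact: (continuous_comp_fun cx cv).
  pose C := [set z : I01 * polyhedron R K | realization L (set_val z.2)].
  have cv : continuous (set_val : set_type C -> _) by exact: set_val_continuous.
  have zC (z : set_type C) : realization L (set_val (set_val z).2).
    exact: (set_valP z : C (set_val z)).
  have ctv : continuous (fun z : set_type C => set_val (set_val z).1).
    exact: (continuous_comp_fun ct cv).
  rewrite (_ : _ \o _ = fun z : set_type C => incl (H (
     set_val (set_val z).1 / Num.max (set_val (set_val z).1) (1 - set_val (set_val z).1),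
     into pL (set_val (set_val z).2)))); last first.
    by apply/funext => z /=; exact: stretch_skeleton.
  apply: (continuous_comp_fun incl_continuous).
  apply: (homotopy_comp_continuous cH) => [z||].
  - by have [] := ratio01 (unit_intervalP (set_val z).1).
  - apply: continuous_div => [z|//|].
      by have [/gt_eqF ->] := ratio01 (unit_intervalP (set_val z).1).
    apply: continuous_maxf => //; apply: continuous_sub => //; exact: cst_continuous.
  - apply: continuous_into => [z|]; first exact: zC.
    apply: (continuous_comp_fun (@set_val_continuous {ptws T -> R} (realization K))).
    exact: (continuous_comp_fun cx cv).
split => x; have Kx : realization K (set_val x) := set_valP x.
  have t00 : 0 <= (0 : R) <= 1 by rewrite lexx ler01.
  have [/existsP[i ix]|/existsPn nx] := boolP [exists i, facet i \subset supp (set_val x)].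
    have [_ [_ KG]] := Kx.
    have xi : supp (set_val x) \subset facet i by rewrite -(facet_max KG ix).
    rewrite (stretch_facet t00 xi); set w := path _ _ _.
    have w0 : w ord0 = gauge (coord i (set_val x)) - 1.
      by rewrite /w path_ord0 subr0 mul0r mul1r addr0.
    have n1 := gauge_coord_le1 i Kx.
    have hw : hat w = coord i (set_val x).
      rewrite /w (hat_path _ Kx xi) mul0r subr0; apply/funext => j.
      by rewrite /scl mul1r.
    (* With height n - 1 and gauge n the denominator is n - (n - 1) = 1, so [cell] inverts
       [path 0]. *)
    rewrite cell_bottom ?w0 ?hw ?subr_le0 // opprB addrCA subrr addr0 invr1.
    rewrite (_ : scl 1 _ = coord i (set_val x)); last first.
      by apply/funext => j; rewrite /scl mul1r.
    by apply: set_val_inj; rewrite pt_coord // intoE.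
  have Lx := realization_skeleton Kx nx.
  rewrite stretch_skeleton // mul0r H0; apply: set_val_inj.
  by rewrite incl_val intoE.
have [/existsP[i ix]|/existsPn nx] := boolP [exists i, facet i \subset supp (set_val x)].
  have [_ [_ KG]] := Kx.
  have xi : supp (set_val x) \subset facet i by rewrite -(facet_max KG ix).
  rewrite (stretch_facet one_itv01 xi) /= (quot_facet xi) attach_lift.
  have nw := path_neq0 one_itv01 Kx xi.
  rewrite /dir intoE; last exact: normalize_sphere.
  rewrite (_ : normalize _ = scl (euclid (path 1 i (set_val x)))^-1 (path 1 i (set_val x))).
    by rewrite cell_scl // invr_gt0 euclid_gt0.
  by apply/funext => j; rewrite /normalize /scl mulrC.
have Lx := realization_skeleton Kx nx.
rewrite stretch_skeleton // /= quot_skeleton // attach_lift.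
rewrite sphere_pt_val cell_base.
by rewrite subrr (max_idPl _) ?ler01 // divr1 H1.
Qed.

(* The straight line from [w] to a multiple of the image of [w] under
   [quot \o attach]; it avoids the origin because the two are never opposite. *)
Definition line (t : R) w : vec :=
  mkvec ((1 - t) * w ord0 + t * (gauge (hat w) ^+ 2 + w ord0 * `|w ord0|))
        (scl ((1 - t) + t * Num.max (- w ord0) 0) (hat w)).

Lemma line_neq0 t w : 0 <= t <= 1 -> (exists j, w j != 0) ->
  exists j, line t w j != 0.
Proof.
move=> /andP[t0 t1] nw; apply: vec_neq0.
have c0 : 0 <= (1 - t) + t * Num.max (- w ord0) 0.
  by rewrite addr_ge0 ?subr_ge0 // mulr_ge0 // le_max lexx orbT.
rewrite hat_mkvec; last exact/sumzero_scl/sumzero_hat.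
rewrite gauge_scl // {1}/line /mkvec eqxx.
have [g0|g0] := eqVneq (gauge (hat w)) 0.
  left; have w0 : w ord0 != 0.
    have [j wj] := nw; have [<-//|j0] := eqVneq j ord0.
    by rewrite (gauge_hat_eq0 g0 j0) eqxx in wj.
  (* With zero gauge the height is [w ord0] times the positive factor 1 - t + t |w ord0|. *)
  rewrite g0 expr0n /= add0r mulrCA mulrC -mulrDr.
  rewrite mulf_neq0 // gt_eqF //.
  have [->|t1'] := eqVneq t 1; first by rewrite subrr add0r mul1r normr_gt0.
  by rewrite ltr_wpDr ?mulr_ge0 // subr_gt0 lt_neqAle t1'.
have [c1|c1] := eqVneq ((1 - t) + t * Num.max (- w ord0) 0) 0; last first.
  by right; rewrite mulf_neq0.
(* A vanishing radial factor forces t = 1 and [w ord0] nonnegative; the height is then at least the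
   square of the positive gauge. *)
left; move/eqP: c1; rewrite paddr_eq0 ?subr_ge0 ?mulr_ge0 ?le_max ?lexx ?orbT //.
rewrite subr_eq0 => /andP[/eqP <-]; rewrite mul1r => /eqP w0.
have w0' : 0 <= w ord0 by rewrite -oppr_le0 -w0 le_max lexx.
rewrite subrr mul0r add0r mul1r gt_eqF // ltr_pwDl ?mulr_ge0 //.
by rewrite exprn_gt0 // lt_neqAle eq_sym g0 gauge_ge0.
Qed.

Lemma line0 w : line 0 w = w.
Proof.
rewrite /line subr0 !mul0r !addr0 mul1r -[RHS]mkvec_hat; congr mkvec.
by apply/funext => j; rewrite /scl mul1r.
Qed.

(** The base point stays fixed at all times, so the homotopies of the single spheres glue over the
    wedge. *)
Lemma line_base t : 0 <= t <= 1 -> dir (line t (sphere_pt_fun R d)) = sphere_pt R d.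
Proof.
move=> t01.
have E : sphere_pt_fun R d = mkvec 1 (fun=> 0) :> vec.
  by apply/funext => j; rewrite /mkvec /sphere_pt_fun; case: eqP.
have h0 : hat (sphere_pt_fun R d : vec) = fun=> 0.
  by rewrite E hat_mkvec // /sumzero big1.
have g0 : gauge (hat (sphere_pt_fun R d : vec)) = 0.
  by rewrite h0 /gauge bigmax_eq_id // => j _; rewrite mulr0 oppr0.
rewrite /line g0 h0 (_ : sphere_pt_fun R d ord0 = 1); last by rewrite /sphere_pt_fun eqxx.
rewrite normr1 expr0n /= add0r !mulr1 subrK.
rewrite (_ : scl _ _ = fun=> 0) ?dir_base //.
by apply/funext => j; rewrite /scl mulr0.
Qed.

Lemma line1_quot i (p : S) : quot (attach (lift i p)) = lift i (dir (line 1 (set_val p))).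
Proof.
rewrite attach_lift; set w : vec := set_val p.
have nw : exists j, w j != 0 by exact: sphere_neq0 (set_valP p).
(* The upper hemisphere lands in the skeleton, hence goes to the base point; there the line ends at
   a positive multiple of the pole. *)
have [w0|/ltW w0] := leP 0 (w ord0).
  have [y ->] : exists y, cell i w = incl y.
    have [wg|/ltW wg] := leP (w ord0) (gauge (hat w)).
      have wg' : 0 <= w ord0 <= gauge (hat w) by rewrite w0.
      by have [g0 ->] := cell_middle i nw wg'; eexists.
    by exists pL; exact: cell_top.
  rewrite quot_skeleton; last by rewrite incl_val; exact: set_valP.
  rewrite /line subrr mul0r !add0r !mul1r ger0_norm //.
  rewrite (_ : scl _ _ = fun=> 0); last first.
    by apply/funext => j; rewrite /scl (max_idPr _) ?oppr_le0 // mul0r.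
  rewrite dir_base ?lift_base // -expr2.
  have [E|w0'] := eqVneq (w ord0) 0.
    by rewrite E expr0n addr0 exprn_gt0 // gauge_hat_neq0.
  by rewrite ltr_wpDl ?sqr_ge0 // exprn_even_gt0.
have D := cell_denom nw w0; have Kw := cell_bottom_realization i nw w0.
rewrite cell_bottom // (@quot_facet i); last by rewrite intoE // supp_pt.
rewrite intoE //; congr (lift i _).
set D0 := gauge _ - _ in D Kw *.
have -> : path 1 i (pt i (scl D0^-1 (hat w))) = scl (D0 ^- 2) (line 1 w).
  apply/funext => j; rewrite /path coord_pt gauge_scl ?invr_ge0 ?(ltW D) //.
  rewrite /line /mkvec /scl (max_idPl _) ?oppr_ge0 // ler0_norm //.
  have D1 : gauge (hat w) - w ord0 != 0 by rewrite gt_eqF.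
  by rewrite /D0; case: eqP => _; field.
by rewrite /dir normalize_scl // invr_gt0 exprn_gt0.
Qed.

Lemma sphere_pt_closed : closed [set sphere_pt R d].
Proof.
(* On the unit sphere the first coordinate reaches 1 only at the pole. *)
rewrite (_ : [set _] = [set p : S | 1 <= set_val p ord0]).
  by apply: closed_le_fun; [exact: cst_continuous|exact: sphere_vcontinuous].
rewrite eqEsubset; split => p /= => [->|p1].
  by rewrite sphere_pt_val /sphere_pt_fun eqxx.
apply: set_val_inj; rewrite sphere_pt_val.
have : sphere R d (set_val p) := set_valP p.
rewrite /sphere /= big_ord_recl => sp.
have s0 : 0 <= \sum_(k < d) set_val p (fintype.lift ord0 k) ^+ 2.
  by apply: sumr_ge0 => k _; exact: sqr_ge0.
have p2 : set_val p ord0 = 1.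
  apply/eqP; rewrite eq_le p1 andbT -(@ler_pXn2r _ 2) ?nnegrE ?(le_trans ler01 p1) //.
  by rewrite expr1n -sp lerDl.
have z0 : \sum_(k < d) set_val p (fintype.lift ord0 k) ^+ 2 = 0.
  by move: sp; rewrite p2 expr1n => /eqP; rewrite -subr_eq0 addrAC subrr add0r => /eqP.
apply/funext => j; rewrite /sphere_pt_fun; case: (unliftP ord0 j) => [k ->|->].
  have : set_val p (fintype.lift ord0 k) ^+ 2 = 0.
    by apply: (psumr_eq0P _ z0) => // k' _; exact: sqr_ge0.
  by move=> /eqP; rewrite sqrf_eq0 => /eqP.
by rewrite p2 eqxx.
Qed.

Lemma line_homotopy : homotopic R W W idfun (quot \o attach).
Proof.
pose f (t : R) := @wedge_fun 'I_m (fun _ => S) (fun _ => sphere_pt R d) _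
  (fun i p => lift i (dir (line t (set_val p)))).
have fbase t i : 0 <= t <= 1 -> lift i (dir (line t (set_val (sphere_pt R d)))) = base.
  move=> t01; rewrite sphere_pt_val.
  by rewrite line_base // lift_base.
have fE t i p : 0 <= t <= 1 -> f t (lift i p) = lift i (dir (line t (set_val p))).
  by move=> t01; rewrite /f /lift wedge_lift_funE // => i' i''; rewrite -!/(lift _ _) !fbase.
exists (fun z => f z.1 z.2); split.
  (* Joint continuity in time and point is deduced from that on each sphere, using that the wedge is
     finite and its base points are closed. *)
  pose k i (t : unit_interval R) (p : S) := lift i (dir (line (set_val t) (set_val p))).
  have := @wedge_fun_joint_continuous 'I_m (fun _ => S : topologicalType)
    (fun _ => sphere_pt R d) (unit_interval R) W k.
  rewrite (_ : uncurry _ = fun p => f (set_val p.1) p.2); last by apply/funext => -[].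
  apply.
  - exact: finite_finset.
  - move=> i; exact: sphere_pt_closed.
  - by move=> t i j; rewrite /k !fbase // unit_intervalP.
  - move=> i; rewrite (_ : uncurry _ =
      fun z => lift i (dir (line (set_val z.1) (set_val z.2)))); last first.
      by apply/funext => -[].
    apply: (continuous_comp_fun (@lift_continuous i)); apply: dir_continuous => [z|].
      by apply: line_neq0 (unit_intervalP _) (sphere_neq0 (set_valP z.2)).
    have ct := @fst_val_continuous R S.
    have cp : vcontinuous (fun z : unit_interval R * S => (set_val z.2 : vec)).
      by move=> j; apply: continuous_ptws_val; exact: snd_continuous.
    have ch := vcontinuous_hat cp; have cg := continuous_gauge ch.
    have c1 : continuous (fun z : unit_interval R * S => 1 - set_val z.1).
      by apply: continuous_sub => //; exact: cst_continuous.
    apply: vcontinuous_mkvec.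
      apply: continuous_add; first by apply: continuous_mul => //; exact: cp.
      apply: continuous_mul => //; apply: continuous_add.
        by exact: (continuous_mul cg cg).
      by apply: continuous_mul; [exact: cp|apply: continuous_norm; exact: cp].
    apply: vcontinuous_scl => //; apply: continuous_add => //; apply: continuous_mul => //.
    by apply: continuous_maxf; [apply: continuous_opp; exact: cp|exact: cst_continuous].
split => y; have [i [p ->]] := liftP y.
  rewrite /= fE ?lexx ?ler01 // line0 /dir normalize_id; last exact: set_valP.
  by congr (lift i _); apply: set_val_inj; rewrite intoE //; exact: set_valP.
by rewrite /= fE ?lexx ?ler01 // line1_quot.
Qed.

Lemma polyhedron_wedge : homotopy_equivalent R (polyhedron R K) W.
Proof.
exists quot, attach; split.
- exact: quot_continuous.
- exact: attach_continuous.
- exact: homotopic_sym stretch_homotopy.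
- exact: homotopic_sym line_homotopy.
Qed.

End facets.

(** * From acyclic matchings to wedges of spheres *)

Section critical_facets.
Variables (R : realType) (V : finType).
Implicit Types (K : pred {set V}) (M A : {set {set V}}) (s G : {set V}).

(** The pair added last is a free face with its only proper coface, so removing it is an elementary
    collapse. *)
Lemma matching_contractible M : acyclic_matching M ->
  downclosed (fun G => G \in M) -> finset.set0 \in M ->
  contractible R (fun G => G \in M).
Proof.
elim => [|{}M s v aM IH vs free] dM M0; first by rewrite inE in M0.
set M' := (s |: _)%SET in dM M0 *.
have sub G : G \in M' -> s \subset G -> G \subset (v |: s)%SET.
  rewrite !inE => /or3P[/eqP ->|/eqP ->//|GM]; first by rewrite finset.subsetUr.
  by rewrite (negPf (free _ GM)).
(* If the empty face is the free one, all faces lie in [[set v]] and the polyhedron is a point; this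
   is where the induction bottoms out. *)
have [s0|s0] := eqVneq s finset.set0.
  apply: (@point_contractible _ _ _ v) => G; apply/idP/idP => [GM|Gv].
    by rewrite -(finset.setU0 [set v]%SET) -s0 sub // s0 finset.sub0set.
  by apply: dM Gv _; rewrite !inE s0 finset.setU0 eqxx orbT.
have ME G : (G \in M') && ~~ (s \subset G) = (G \in M).
  apply/andP/idP => [[]|GM]; last by rewrite !inE GM !orbT free.
  rewrite !inE => /or3P[/eqP ->|/eqP ->|//]; first by rewrite fintype.subxx.
  by rewrite finset.subsetUr.
apply: (@collapse_contractible _ _ _ s v) => //; first by rewrite !inE eqxx orbT.
apply: (@eq_contractible _ _ (fun G => G \in M)) => [G|]; first by rewrite ME.
apply: IH => [G H GH|].
  rewrite -!ME => /andP[HM sH]; rewrite (dM _ _ GH HM) /=.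
  by apply: contraNN sH => sG; exact: fintype.subset_trans GH.
by rewrite -ME M0 finset.subset0.
Qed.

Theorem wedge_of_critical_facets K A d :
    downclosed K -> (0 < #|A|)%N ->
    (forall s, s \in A -> K s) -> (forall s, s \in A -> #|s| = d.+1) ->
    (forall s G, s \in A -> K G -> s \subset G -> G = s) ->
    acyclic_matching [set G | K G && (G \notin A)]%SET ->
  homotopy_equivalent R (polyhedron R K) (wedge_spheres R #|A| d).
Proof.
move=> dK A0 AK Ad Amax aM.
have [s0 s0A] : exists s, s \in A by apply/finset.set0Pn; rewrite -card_gt0.
have [v0 _] : exists v, v \in s0 by apply/finset.set0Pn; rewrite -card_gt0 Ad.
pose S (i : 'I_#|A|) : {set V} := enum_val i.
have SA i : S i \in A by exact: enum_valP.
pose e (i : 'I_#|A|) (j : 'I_d.+1) := nth v0 (enum (S i)) j.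
have size_e i : size (enum (S i)) = d.+1 by rewrite -cardE Ad.
have e_inj i : injective (e i).
  move=> j k /eqP; rewrite nth_uniq ?enum_uniq ?size_e // => /eqP.
  exact: val_inj.
have facetE i : facet e i = S i.
  apply/finset.setP => v; rewrite inE; apply/existsP/idP => [[j /eqP ->]|vS].
    by rewrite -mem_enum mem_nth // size_e.
  have vi : (index v (enum (S i)) < d.+1)%N by rewrite -(size_e i) index_mem mem_enum.
  by exists (Ordinal vi); rewrite /e /= nth_index // mem_enum.
have LE : open_skeleton K e =1 fun G => G \in [set G | K G && (G \notin A)]%SET.
  move=> G; rewrite /open_skeleton inE; congr (_ && _).
  apply/forallP/idP => [nG|GA i]; last by rewrite facetE; apply: contraNneq GA => ->.
  apply/negP => GA; have := nG (enum_rank_in GA G).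
  by rewrite facetE /S enum_rankK_in ?eqxx.
have [p [H [cH [H0 H1]]]] : contractible R (open_skeleton K e).
  apply: (@eq_contractible _ _ _ _ (fsym LE)); apply: matching_contractible => //.
    move=> G H GH; rewrite !inE => /andP[KH HA]; rewrite (dK _ _ GH KH) /=.
    by apply: contraNN HA => GA; rewrite (Amax _ _ GA KH GH).
  (* The empty face is matched, because critical faces have [d.+1] vertices. *)
  rewrite inE (dK _ _ (finset.sub0set _) (AK _ s0A)) /=.
  by apply/negP => /Ad; rewrite cards0.
apply: (@polyhedron_wedge R V K _ d e dK e_inj _ _ _ p H cH H0 H1 (enum_rank_in s0A s0)).
- by move=> i; rewrite facetE AK.
- by move=> i G KG; rewrite facetE => /Amax; apply.
- by move=> i j; rewrite !facetE => /enum_val_inj.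
Qed.

End critical_facets.

Theorem mainTheorem13 (R : realType) (n : nat) (F : {set {set 'I_n.+1}}) :
  (3 <= n)%N -> wface n F ->
  htpy_wedge_of_spheres R (wlink n F)
    ((ncomponents F).-1`! * \prod_(S in F) (nchildren F S).-1`!)%N
    (n%:Z - 4 - #|F|%:Z).
Proof.
move=> n3 wF; have [A [lA cA mA wA aM]] := critical_exists n3 wF.
have A0 : (0 < #|A|)%N.
  by rewrite wA /weight; apply: prodn_gt0 => T; exact: fact_gt0.
have [G0 G0A] : exists G, G \in A by apply/card_gt0P.
rewrite -(weightE n3 wF) -wA.
(* If |F| = n - 3, dimension -1, critical faces are empty, so the empty face is the only one; being
   maximal it is the whole link, and the weight is 1. *)
have [Fn|Fn] := eqVneq #|F| (n - 3)%N.
  have -> : n%:Z - 4 - #|F|%:Z = Negz 0 by rewrite Fn NegzE; lia.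
  have A1 G : G \in A -> G = finset.set0.
    move=> /cA; rewrite Fn => Gn; apply/eqP; rewrite -cards_eq0; lia.
  have G00 := A1 _ G0A; rewrite G00 in G0A; split.
    move=> G; apply/idP/eqP => [lG|->]; last exact: lA.
    exact: mA G0A lG (finset.sub0set _).
  apply/eqP; rewrite eqn_leq A0 andbT; apply/card_le1P.
  by move=> G /A1 -> H; rewrite inE; apply/idP/eqP => [/A1|->].
have FN := cA _ G0A.
(* The truncated subtraction is exact: [FN] bounds |F| by n - 3, and equality has been excluded. *)
pose d := (n - 4 - #|F|)%N.
have -> : n%:Z - 4 - #|F|%:Z = Posz d by rewrite /d; move: #|F| #|G0| Fn FN => p q; lia.
apply: wedge_of_critical_facets => //.
- by move=> G H GH; exact: wlink_sub.
- move=> G /cA; rewrite /d; move: #|F| #|G| Fn => p q; lia.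
Qed.
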